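(* Fix $p\in(0,1)$ and, for $\lambda\in(1-p,1)$, let $$L(p,\lambda)=\left\lceil \log_{\lambda/(1-p)}\frac{p}{1-\lambda}\right\rceil .$$ Let $\pi_{\mathrm{th}}^{L}$ denote the $L$-threshold policy. Then: (1) $\pi_{\mathrm{th}}^{L(p,\lambda)}$ is feasible for all $\lambda\in(1-p,1)$. (2) $\pi_{\mathrm{th}}^{L(p,\lambda)}$ is asymptotically optimal in the class $\Pi_0$ of online policies as $\lambda\to1$: $$C\bigl(p,\lambda,\pi_{\mathrm{th}}^{L(p,\lambda)}\bigr)\sim C^{*}_{\Pi_0}(p,\lambda)\sim\log_{1/(1-p)}\frac{1}{1-\lambda}\qquad\text{as }\lambda\to1 .$$
   Context: Model. Fix $p\in(0,1)$, $\lambda\in(0,1)$. Jobs arrive to a single queue (unbounded buffer, empty at time $0$) according to a Poisson process of rate $\lambda$; service tokens are generated by an independent Poisson process of rate $1-p$. Without deletions, each arrival increases the queue length by 1; each token decreases it by 1 if the queue is nonempty and otherwise is wasted (no effect). Let $Q^0(t)\in\mathbb{Z}_+$, $t\ge 0$, be the (right-continuous) queue length process without deletions. An event is an arrival or a token generation (wasted or not); $T_n$ is the time of the $n$th event, and $Q^0[n]$ is the queue length immediately after the $n$th event, $Q^0[0]=0$. The path $Q^0$ is called the initial sample path. Deletions. For a discrete-time path $Q$, $\Phi(Q)=\{n\in\mathbb{N}: Q[n]>Q[n-1]\}$ is the set of arrival slots. For $M\subset\mathbb{Z}_+$, $I(M,n)=|\{1,\dots,n\}\cap M|$. A sequence $M=\{m_i\}$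 (possibly finite) is a feasible deletion sequence for $Q^0$ if its elements are distinct, $M\subset\Phi(Q^0)$, and $\limsup_{n\to\infty}\frac1n I(M,n)\le\frac{p}{\lambda+1-p}$ almost surely. The point-wise deletion map $D_P(Q,m)=Q'$ is given by $Q'[n]=Q[n]-1$ if $n\ge m$ and $Q[t]>0$ for all $t\in\{m,\dots,n\}$, and $Q'[n]=Q[n]$ otherwise. The multi-point deletion map $D(Q^0,M)$ is the pointwise limit (over $i\to |M|$ or $\infty$) of $Q^i=D_P(Q^{i-1},m_i)$. Policies. The sample path of $Q^0$ is regarded as containing all relevant information on arrivals and tokens (in particular the event times). For $w\in\mathbb{R}_+\cup\{\infty\}$, let $\mathcal{F}_t=\sigma(Q^0(s);s\le t)$ and $\mathcal{F}_\infty=\bigcup_t\mathcal{F}_t$. A $w$-lookahead deletion policy is a mapping $\pi$ of the path $Q^0$ to a sequence $M=\pi(Q^0)$ (possibly using internal randomness) such that $M$ is a feasible deletion sequence a.s., and the event $\{n\in M\}$ is $\mathcal{F}_{T_n+w}$-measurable for all $n\in\mathbb{N}$. $\Pi_w$ is the set of all $w$-lookahead policies; $\Pi_0$ is the class of online policies. A policy is called feasible if the deletion sequence it outputs is a feasible deletion sequence a.s. Performance. $C(p,\lambda,\pi)=\mathbb{E}\bigl(\limsup_{n\to\infty}\frac1n\sum_{k=1}^n Q_\pi^\infty[k]\bigr)$ with $Q^\infty_\pi=D(Q^0,\pi(Q^0))$, the expectation being over $Q^0$ and any internal randomness of $\pi$. $C^*_{\Pi_w}(p,\lambda)=\inf_{\pi\in\Pi_w}C(p,\lambda,\pi)$.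 Threshold policy. $\pi_{\mathrm{th}}^L$ deletes a job arriving at time $t$ if and only if the queue length (after the effect of all earlier deletions, seen by the arriving job) at time $t$ is greater than or equal to $L$. Notation. $f(\lambda)\sim g(\lambda)$ as $\lambda\to1$ means $f(\lambda)/g(\lambda)\to1$ (as $\lambda\uparrow1$, with $p$ fixed). *)

(* Defs.v *)
From HB Require Import structures.
From mathcomp Require Import all_boot all_order all_algebra.
From mathcomp Require Import all_classical all_reals all_analysis.
Set Implicit Arguments.
Unset Strict Implicit.
Unset Printing Implicit Defensive.
Import Order.TTheory GRing.Theory Num.Theory.
Import numFieldNormedType.Exports.
Local Open Scope classical_set_scope.
Local Open Scope ring_scope.

Section PoissonProcess.
Context (R : realType) (d : measure_display) (T : measurableType d).
Variable P : probability T R.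
Implicit Types (rate : R) (N A S : R -> T -> nat).

(* [N t w] is the number of points of the process in the time interval [0, t];
   only the times [0 <= t] are meaningful. *)
Record poisson_process rate N : Prop := {
  poisson_measurable : forall t k, 0 <= t -> measurable [set w | N t w = k];
  poisson_start : forall w, N 0 w = 0%N;
  poisson_nondecreasing :
    forall w s t, 0 <= s -> s <= t -> (N s w <= N t w)%N;
  poisson_right_continuous :
    forall w t, 0 <= t -> \forall s \near t^'+, N s w = N t w;
  poisson_increments : forall s t k, 0 <= s -> s < t ->
    P [set w | (N t w - N s w)%N = k] = (poisson_pmf (rate * (t - s)) k)%:E;
  poisson_independent_increments :
    forall (n : nat) (t : nat -> R) (B : nat -> set nat),
    0 <= t 0%N -> (forall i, t i <= t i.+1) ->
    P (\bigcap_(i < n) [set w | B i (N (t i.+1) w - N (t i) w)%N])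
    = (\prod_(i < n) P [set w | B i (N (t i.+1) w - N (t i) w)%N])%E }.

Definition process_events N (J : set R) : set (set T) :=
  [set E | exists s (B : set nat), J s /\ E = [set w | B (N s w)]].

Definition independent_processes A S : Prop :=
  forall E F, <<s process_events A [set t | 0 <= t] >> E ->
              <<s process_events S [set t | 0 <= t] >> F ->
  P (E `&` F) = (P E * P F)%E.

End PoissonProcess.

(* The information carried by a sample path: the arrivals and the tokens
   (wasted or not) generated up to each time. *)
Record epath (R : realType) := EPath {
  arrivals : R -> nat;
  tokens : R -> nat }.

Section InitialPath.
Context (R : realType).
Implicit Types (x : epath R) (n : nat).

Definition event_time x n : \bar R :=
  ereal_inf [set t%:E | t in
    [set t : R | 0 <= t /\ (n <= arrivals x t + tokens x t)%N]].

(* Almost surely the event times are finite and strictly increasing, and then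
   the n-th event (n >= 1) is an arrival iff the number of arrivals changes
   between the (n-1)-th and the n-th event times. *)
Definition event_is_arrival x n : bool :=
  (arrivals x (fine (event_time x n.-1))
     < arrivals x (fine (event_time x n)))%N.

Fixpoint initial_queue x n : nat :=
  if n is n'.+1 then
    if event_is_arrival x n then (initial_queue x n').+1
    else (initial_queue x n').-1
  else 0%N.

End InitialPath.

Section Deletions.
Implicit Types (Q : nat -> nat) (m n : nat).

Definition arrival_slot Q n : bool := (0 < n)%N && (Q n.-1 < Q n)%N.

(* A possibly finite sequence m_0, m_1, ...: [None] marks the positions after
   its end. *)
Definition slot_seq := nat -> option nat.

Definition is_slot_seq (M : slot_seq) : Prop :=
  forall i j, (i <= j)%N -> M i = None -> M j = None.

Definition slots (M : slot_seq) : set nat := [set m | exists i, M i = Some m].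

Definition count_slots (M : slot_seq) n : nat :=
  \sum_(1 <= k < n.+1) `[< slots M k >].

Definition delete_slot Q m : nat -> nat := fun n =>
  if (m <= n)%N && all (fun t => 0 < Q t)%N (index_iota m n.+1)
  then (Q n - 1)%N else Q n.

Fixpoint delete_first Q (M : slot_seq) (i : nat) : nat -> nat :=
  if i is i'.+1 then
    if M i' is Some m then delete_slot (delete_first Q M i') m
    else delete_first Q M i'
  else Q.

Definition delete Q (M : slot_seq) : nat -> nat :=
  fun n => limn (fun i => delete_first Q M i n).

Definition feasible_deletion (R : realType) (p lam : R) Q (M : slot_seq) :=
  [/\ is_slot_seq M,
      (forall i j m, M i = Some m -> M j = Some m -> i = j),
      slots M `<=` [set n | arrival_slot Q n] &
      (limn_esup (fun n => ((count_slots M n)%:R / n%:R)%:E)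
         <= (p / (lam + 1 - p))%:E)%E].

Definition avg_queue (R : realType) Q : \bar R :=
  limn_esup (fun n => ((\sum_(1 <= k < n.+1) Q k)%:R / n%:R : R)%:E).

(* The increasing enumeration of [a]: its i-th element (from 0) is the member
   of [a] with exactly i smaller members. *)
Definition increasing_enum (a : pred nat) : slot_seq := fun i =>
  if pselect (exists n, a n && (count a (iota 0 n) == i)) is left h
  then Some (ex_minn h) else None.

End Deletions.

(* A policy maps sample paths to slot sequences, with the help of a random
   seed, which is drawn independently of the sample path. *)
Record policy (R : realType) := Policy {
  seed_display : measure_display;
  seed : measurableType seed_display;
  seed_law : probability seed R;
  deletions : epath R -> seed -> slot_seq }.
Arguments deletions {R} p _ _.
Arguments seed_law {R} p.

Section Threshold.
Context (R : realType).

(* The slots among 1, ..., n deleted by the L-threshold policy, in increasing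
   order. *)
Fixpoint threshold_slots (L : int) (x : epath R) (n : nat) : seq nat :=
  if n is n'.+1 then
    let s := threshold_slots L x n' in
    let seen := foldl delete_slot (initial_queue x) s n' in
    if arrival_slot (initial_queue x) n && (L <= seen%:Z) then rcons s n else s
  else [::].

Definition threshold_policy (L : int) : policy R :=
  {| seed := unit : measurableType _;
     seed_law := dirac tt;
     deletions := fun x _ =>
       increasing_enum [pred n | n \in threshold_slots L x n] |}.

End Threshold.

Record queue_model (R : realType) := QueueModel {
  model_display : measure_display;
  model_space : measurableType model_display;
  model_law : probability model_space R;
  model_arrivals : R -> model_space -> nat;
  model_tokens : R -> model_space -> nat }.

Section Model.
Context (R : realType).
Variables (p lam : R) (X : queue_model R).
Implicit Types (pol : policy R) (w : \bar R).

Record valid_model : Prop := {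
  valid_arrivals : poisson_process (model_law X) lam (@model_arrivals R X);
  valid_tokens : poisson_process (model_law X) (1 - p) (@model_tokens R X);
  valid_independent : independent_processes (model_law X)
    (@model_arrivals R X) (@model_tokens R X) }.

Definition sample_path (o : model_space X) : epath R :=
  {| arrivals := fun t => model_arrivals t o;
     tokens := fun t => model_tokens t o |}.

Definition path_events (J : set R) : set (set (model_space X)) :=
  process_events (@model_arrivals R X) J
  `|` process_events (@model_tokens R X) J.

Definition filtration (t : R) : set (set (model_space X)) :=
  <<s path_events [set s | 0 <= s <= t] >>.

Definition filtration_oo : set (set (model_space X)) :=
  <<s \bigcup_(t in [set t | 0 <= t]) filtration t >>.

(* The sigma-algebra at a stopping time; it is [filtration_oo] when
   [tau = +oo]. *)
Definition filtration_at (tau : model_space X -> \bar R)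
    : set (set (model_space X)) :=
  [set E | filtration_oo E /\
     forall t, 0 <= t -> filtration t (E `&` [set o | (tau o <= t%:E)%E])].

(* The product of [F] with the sigma-algebra of the seed. *)
Definition with_seed pol (F : set (set (model_space X)))
    : set (set (model_space X * seed pol)) :=
  <<s [set G | exists E H, [/\ F E, measurable H & G = E `*` H]] >>.
Arguments with_seed : clear implicits.

Definition joint_law pol := (model_law X \x seed_law pol)%E.
Arguments joint_law : clear implicits.

Definition feasible_policy pol : Prop :=
  {ae joint_law pol, forall z : model_space X * seed pol,
    feasible_deletion p lam (initial_queue (sample_path z.1))
      (deletions pol (sample_path z.1) z.2)}.

Definition lookahead w pol : Prop :=
  feasible_policy pol /\
  forall n, (0 < n)%N ->
    with_seed pol
      (filtration_at (fun o => event_time (sample_path o) n + w)%E)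
      [set z | slots (deletions pol (sample_path z.1) z.2) n].

Definition online pol : Prop := lookahead 0%E pol.

Definition cost pol : \bar R :=
  (\int[joint_law pol]_z
     avg_queue R (delete (initial_queue (sample_path z.1))
                         (deletions pol (sample_path z.1) z.2)))%E.

Definition optimal_cost (Pi : policy R -> Prop) : \bar R :=
  ereal_inf [set c | exists2 pol, Pi pol & cost pol = c].

End Model.

Definition log_base (R : realType) (b x : R) : R := ln x / ln b.

Definition threshold_level (R : realType) (p lam : R) : int :=
  Num.ceil (log_base (lam / (1 - p)) (p / (1 - lam))).

Definition asymp_at_1 (R : realType) (f g : R -> R) : Prop :=
  f lam / g lam @[lam --> 1^'-] --> (1 : R).

(* Main.v *)
Require Import Defs.
From mathcomp Require Import all_boot all_order all_algebra.
From mathcomp Require Import all_classical all_reals all_analysis.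
From mathcomp Require Import measurable_realfun zify ring lra.
Set Implicit Arguments.
Unset Strict Implicit.
Unset Printing Implicit Defensive.
Import Order.TTheory GRing.Theory Num.Theory.
Import numFieldNormedType.Exports.
Local Open Scope classical_set_scope.
Local Open Scope ring_scope.

(** Write [mu] for lam + 1 - p, [alpha] for lam / mu, [beta] for (1 - p) / mu,
    [sigma] for lam / (1 - p) and [r] for p / mu.

    Reduction to a chain. Deleting arrivals of the initial path amounts to
    suppressing the corresponding upward steps: the resulting queue obeys the
    same recursion, with the deleted arrivals skipped ([deleteE]). The next
    event is an arrival with probability [alpha], independently of all that is
    known at the current event ([next_event_arrival]): the strong Markov
    property of the two Poisson processes, obtained here by summing over the
    cells of a fine grid. So an online policy controls a nearest-neighbour
    chain on the nonnegative integers with up-probability [alpha] and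
    down-probability [beta], by turning up-steps into pauses. What remains of
    the model is recorded in [decision_process].

    Lower bound. Balancing the flow across each level, the mass at level q of
    the occupation measure of such a chain is at most [sigma] times the mass at
    level q - 1. Wasted tokens occur at rate [beta] times the mass at 0, and
    they are compensated by deletions in excess of alpha - beta; the budget [r]
    exceeds this by only (1 - lam) / mu, so the mass at 0 is at most
    (1 - lam) / (1 - p). The levels below m hence carry little mass as long as
    (1 - lam) * sigma ^ m is small, that is, for m up to nearly the logarithm of
    1 / (1 - lam) in base 1 / (1 - p), and the mean queue is at least nearly m.
    The proof uses the dual of this argument, a potential function with a price
    on deletions ([online_cost_lower_bound]). It tests a truncated cost, for
    which Fatou's lemma compares the expectation of the limit superior with the
    limit of the expectations ([cost_lower_bound]).

    Upper bound. Under the threshold policy with level L the queue never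
    exceeds L, so the cost is at most L. The deletion frequency is controlled
    by another potential, whose increments solve the Poisson equation of the
    chain with drift [r] below L; at L the drift condition follows from
    sigma ^ L >= p / (1 - lam), the inequality that L is made for. Exponential
    moments and the Borel-Cantelli lemma give the almost sure bound
    ([threshold_frequency]).

    As lam tends to 1, both m and L are equivalent to the logarithm of
    1 / (1 - lam) in base 1 / (1 - p). *)

(** * Deletions suppress steps of the queue *)

Section ControlledQueue.
Local Open Scope nat_scope.
Implicit Types (a D : pred nat) (n m : nat).

(** The queue driven by a record of the arrival slots ([a]; all other slots are
    tokens) in which the arrivals in [D] are suppressed. *)
Fixpoint controlled_queue a D n : nat :=
  if n is n'.+1 then
    if a n then (if D n then controlled_queue a D n' else (controlled_queue a D n').+1)
    else (controlled_queue a D n').-1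
  else 0%N.

Lemma eq_controlled_queue a D D' n :
  (forall k, (0 < k <= n)%N -> D k = D' k) ->
  controlled_queue a D n = controlled_queue a D' n.
Proof.
elim: n => [//|n IH] eD /=; rewrite IH; last first.
  by move=> k /andP[k0 kn]; apply: eD; rewrite k0 ltnW.
by rewrite eD // ltnS leqnn.
Qed.

Lemma initial_queueE (R : realType) (x : epath R) :
  initial_queue x = controlled_queue (event_is_arrival x) pred0.
Proof. by apply/funext; elim=> [//|n IH] /=; rewrite IH. Qed.

Lemma arrival_slot_initial (R : realType) (x : epath R) n :
  arrival_slot (initial_queue x) n = (0 < n)%N && event_is_arrival x n.
Proof.
rewrite /arrival_slot; case: n => [//|n] /=.
by case: ifP => _; [rewrite ltnSn|apply/negbTE; rewrite -leqNgt leq_pred].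
Qed.

(** From slot [m] on, the two paths differ by one until the original path first
    empties; a token generated at that moment is wasted on the shorter path, and
    the two coincide from then on. This is the busy-period clause of the
    point-wise deletion. *)
Lemma delete_slot_controlled a D m :
  (0 < m)%N -> a m -> ~~ D m ->
  delete_slot (controlled_queue a D) m =
  controlled_queue a (fun n => (n == m) || D n).
Proof.
move=> m0 am Dm; apply/funext => n.
set Q := controlled_queue a D; set Q' := controlled_queue a _.
have before k : (k < m)%N -> Q' k = Q k.
  move=> km; apply: eq_controlled_queue => j /andP[_ jk].
  by rewrite ltn_eqF // (leq_ltn_trans jk).
pose busy k := all (fun t => 0 < Q t)%N (index_iota m k.+1).
have busyS k : (m <= k)%N -> busy k.+1 = busy k && (0 < Q k.+1)%N.
  move=> mk; rewrite /busy /index_iota (_ : k.+2 - m = (k.+1 - m) + 1)%N; last by lia.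
  by rewrite iotaD all_cat /= andbT subnKC // ltnW.
have after k : if busy (m + k) then Q (m + k)%N = (Q' (m + k)).+1 else Q' (m + k)%N = Q (m + k)%N.
  elim: k => [|k].
    rewrite addn0 /busy /index_iota subSnn /= andbT.
    move: m0 am Dm before; rewrite /Q /Q'; case: (m) => [//|j] _ /= aj /negbTE Dj before.
    by rewrite aj Dj eqxx /= -/Q' before.
  rewrite addnS busyS ?leq_addr //.
  have -> : Q (m + k).+1 = if a (m + k).+1 then
      (if D (m + k).+1 then Q (m + k) else (Q (m + k)).+1) else (Q (m + k)).-1 by [].
  have -> : Q' (m + k).+1 = if a (m + k).+1 then
      (if D (m + k).+1 then Q' (m + k) else (Q' (m + k)).+1) else (Q' (m + k)).-1.
    by rewrite {1}/Q' /= gtn_eqF ?ltnS ?leq_addr.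
  case: (busy (m + k)) => /= ->; case: (a _); case: (D _) => //=; by case: (Q' (m + k)).
rewrite /delete_slot; case: leqP => [mn|nm] /=; last by rewrite before.
have := after (n - m)%N; rewrite subnKC // -/(busy n).
by case: (busy n) => -> //; rewrite subn1.
Qed.

Lemma foldl_delete_slot a D (s : seq nat) :
  uniq s -> all (fun m => [&& 0 < m, a m & ~~ D m])%N s ->
  foldl delete_slot (controlled_queue a D) s =
  controlled_queue a (fun n => (n \in s) || D n).
Proof.
elim: s D => [|m s IH] D /=; first by [].
case/andP=> ms us /andP[/and3P[m0 am Dm] sD].
rewrite delete_slot_controlled // IH //; last first.
  apply/allP => k ks; have /allP/(_ k ks)/and3P[-> -> Dk] := sD.
  by rewrite negb_or Dk !andbT; apply: contraNneq ms => <-.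
by congr controlled_queue; apply/funext => n; rewrite in_cons orbCA orbA.
Qed.

(** The queue at [n] depends only on the deletions among the slots 1, ..., [n],
    which have all been carried out after finitely many steps of the sequence.
    Distinctness matters here: a slot met twice would remove another job. *)
Lemma deleteE (R : realType) (x : epath R) (M : slot_seq) n :
  (forall i j m, M i = Some m -> M j = Some m -> i = j) ->
  slots M `<=` [set n | arrival_slot (initial_queue x) n] ->
  delete (initial_queue x) M n =
  controlled_queue (event_is_arrival x) (fun k => `[< slots M k >]) n.
Proof.
move=> Minj Marr; pose a := event_is_arrival x.
pose deleted i := fun k => [exists j : 'I_i, M j == Some k].
have first_ i : delete_first (initial_queue x) M i = controlled_queue a (deleted i).
  elim: i => [|i IH] /=.
    rewrite initial_queueE; congr controlled_queue; apply/funext => k.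
    by apply/esym/existsP => -[[]].
  have deletedS k : deleted i.+1 k = (M i == Some k) || deleted i k.
    apply/existsP/orP => [[[j ji] /= /eqP Mj]|[Mi|/existsP[j Mj]]].
    - move: ji; rewrite ltnS leq_eqVlt => /predU1P[<-|ji]; first by left; apply/eqP.
      by right; apply/existsP; exists (Ordinal ji); apply/eqP.
    - by exists ord_max.
    - by exists (widen_ord (leqnSn i) j).
  case Mi : (M i) => [m|]; rewrite IH; last first.
    congr controlled_queue; apply/funext => k; rewrite deletedS Mi.
    by [].
  have : arrival_slot (initial_queue x) m by apply: Marr; exists i.
  rewrite arrival_slot_initial => /andP[m0 am].
  rewrite delete_slot_controlled //.
    congr controlled_queue; apply/funext => k; rewrite deletedS Mi.
    by congr orb; apply/eqP/eqP => [->|[]].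
  apply/existsP => -[j /eqP Mj]; have := Minj _ _ _ Mi Mj.
  by move/eqP; rewrite gtn_eqF.
have [i0 Hi0] : exists i0, forall i, (i0 <= i)%N -> forall k, (0 < k <= n)%N ->
    deleted i k = `[< slots M k >].
  elim: n => [|n [i0 IH]]; first by exists 0%N => i _ [|k] // /andP[].
  have [[j Mj]|nM] := pselect (slots M n.+1).
    exists (maxn i0 j.+1) => i; rewrite geq_max => /andP[i0i ji] k /andP[k0].
    rewrite leq_eqVlt => /predU1P[->|kn]; last by rewrite IH // k0.
    rewrite (asboolT (ex_intro _ j Mj)); apply/existsP.
    by exists (Ordinal ji); apply/eqP.
  exists i0 => i i0i k /andP[k0].
  rewrite leq_eqVlt => /predU1P[->|kn]; last by rewrite IH // k0.
  rewrite (asboolF nM); apply/existsP => -[j /eqP Mj].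
  by apply: nM; exists j.
rewrite /delete; apply: (@cvg_lim _ (@discrete_hausdorff nat)).
apply: cvg_near_cst; exists i0 => // i /= i0i.
by rewrite first_; apply: eq_controlled_queue => k kn; exact: Hi0.
Qed.

End ControlledQueue.

(** * The threshold rule as a recursion *)

Section IncreasingEnum.
Local Open Scope nat_scope.
Variable a : pred nat.

Lemma count_iotaS n : count a (iota 0 n.+1) = count a (iota 0 n) + a n.
Proof. by rewrite -addn1 iotaD count_cat /= addn0. Qed.

Lemma count_iota_lt n n' : a n -> n < n' -> count a (iota 0 n) < count a (iota 0 n').
Proof.
move=> an; elim: n' => [//|n' IH]; rewrite ltnS leq_eqVlt count_iotaS.
by case/predU1P => [<-|/IH h]; [rewrite an addn1|rewrite ltn_addr].
Qed.

Lemma increasing_enumP i n :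
  increasing_enum a i = Some n <-> a n && (count a (iota 0 n) == i).
Proof.
have uniq_n n1 n2 : a n1 && (count a (iota 0 n1) == i) ->
    a n2 && (count a (iota 0 n2) == i) -> n1 = n2.
  move=> /andP[a1 /eqP c1] /andP[a2 /eqP c2].
  case: (ltngtP n1 n2) => // h; have := count_iota_lt _ h.
    by rewrite c1 c2 ltnn => /(_ a1).
  by rewrite c1 c2 ltnn => /(_ a2).
rewrite /increasing_enum; case: pselect => [h|h]; last first.
  by split=> // an; case: h; exists n.
case: ex_minnP => m am _; split=> [[<-]//|an]; congr Some; exact: uniq_n.
Qed.

Lemma slots_increasing_enum : slots (increasing_enum a) = [set n | a n].
Proof.
apply/seteqP; split=> n /=.
  by case=> i /increasing_enumP/andP[].
by move=> an; exists (count a (iota 0 n)); apply/increasing_enumP; rewrite an eqxx.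
Qed.

Lemma increasing_enum_inj i j m :
  increasing_enum a i = Some m -> increasing_enum a j = Some m -> i = j.
Proof. by move=> /increasing_enumP/andP[_ /eqP<-] /increasing_enumP/andP[_ /eqP]. Qed.

(** The number of smaller members grows by at most one at a time along the
    integers, so an enumeration that reaches [j] has taken every value below. *)
Lemma increasing_enum_is_slot_seq : is_slot_seq (increasing_enum a).
Proof.
move=> i j ij Mi; case Mj : (increasing_enum a j) => [m|//]; exfalso.
suff [k /increasing_enumP] : exists k, a k && (count a (iota 0 k) == i) by rewrite Mi.
have /increasing_enumP/andP[am /eqP cm] := Mj.
have [->|nij] := eqVneq i j; first by exists m; rewrite am cm eqxx.
have : i < count a (iota 0 m) by lia.
elim: m {Mj am cm} => [//|m IH]; rewrite count_iotaS.
case: (ltnP i (count a (iota 0 m))) => [/IH//|h1 h2].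
by exists m; move: h2; case: (a m) => /= h2; [apply/eqP|]; lia.
Qed.

End IncreasingEnum.

Section ThresholdPath.
Context (R : realType) (L : int) (x : epath R).
Local Open Scope nat_scope.


Definition threshold_deletes n : bool := n \in threshold_slots L x n.

Lemma threshold_slots_bound n k : k \in threshold_slots L x n -> 0 < k <= n.
Proof.
elim: n => [//|n IH] /=; case: ifP => _; rewrite ?mem_rcons ?in_cons.
  by case/predU1P => [->|/IH]; lia.
by move/IH; lia.
Qed.

Lemma mem_threshold_slots n k :
  (k \in threshold_slots L x n) = (0 < k <= n) && threshold_deletes k.
Proof.
elim: n => [|n IH].
  by rewrite in_nil; case: k.
have [kn|kn] := eqVneq k n.+1.
  by rewrite kn leqnn.
rewrite [LHS]/=; have -> : (0 < k <= n.+1) = (0 < k <= n) by lia.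
by rewrite -IH; case: ifP; rewrite // mem_rcons in_cons (negbTE kn).
Qed.

Lemma threshold_slots_ok n :
  uniq (threshold_slots L x n) /\
  all (fun m => [&& 0 < m, event_is_arrival x m & ~~ pred0 m]) (threshold_slots L x n).
Proof.
elim: n => [//|n [u h]] /=; case: ifP => [/andP[sl _]|_]; last by split.
rewrite rcons_uniq u all_rcons /= h andbT andbT; split.
  apply/negP => mem; have := threshold_slots_bound mem.
  by rewrite ltnn andbF.
by move: sl; rewrite arrival_slot_initial andbT.
Qed.

Lemma threshold_seen n :
  foldl delete_slot (initial_queue x) (threshold_slots L x n) n =
  controlled_queue (event_is_arrival x) threshold_deletes n.
Proof.
have [u h] := threshold_slots_ok n.
rewrite initial_queueE foldl_delete_slot //; apply: eq_controlled_queue => k kn.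
by rewrite mem_threshold_slots kn orbF.
Qed.

(** The queue seen by an arriving job, defined by carrying out the earlier
    deletions on the initial path, is the controlled queue itself. *)
Lemma threshold_deletesE n : threshold_deletes n.+1 =
  event_is_arrival x n.+1 &&
  (L <= (controlled_queue (event_is_arrival x) threshold_deletes n)%:Z)%R.
Proof.
rewrite {1}/threshold_deletes /= -threshold_seen arrival_slot_initial /=.
case: ifP => h; first by rewrite mem_rcons mem_head.
by apply/negP => /threshold_slots_bound; lia.
Qed.

Lemma threshold_queue_le n : (0 <= L)%R ->
  ((controlled_queue (event_is_arrival x) threshold_deletes n)%:Z <= L)%R.
Proof.
move=> L0; elim: n => [//|n IH] /=; rewrite threshold_deletesE.
case: event_is_arrival => /=; last by lia.
by case: ifP => //; lia.
Qed.

Lemma slots_threshold_policy s :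
  slots (deletions (threshold_policy R L) x s) = [set n | threshold_deletes n].
Proof. exact: slots_increasing_enum. Qed.

Lemma threshold_policy_slots_ok s (M := deletions (threshold_policy R L) x s) :
  [/\ is_slot_seq M, (forall i j m, M i = Some m -> M j = Some m -> i = j) &
      slots M `<=` [set n | arrival_slot (initial_queue x) n]].
Proof.
split; first exact: increasing_enum_is_slot_seq.
  exact: increasing_enum_inj.
rewrite slots_threshold_policy => -[|n] h; first by [].
by move: h; rewrite /= threshold_deletesE arrival_slot_initial => /andP[].
Qed.

Lemma threshold_policy_queue s n :
  delete (initial_queue x) (deletions (threshold_policy R L) x s) n =
  controlled_queue (event_is_arrival x) threshold_deletes n.
Proof.
have [_ inj sub] := threshold_policy_slots_ok s.
rewrite deleteE //; apply: eq_controlled_queue => k _.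
by rewrite slots_threshold_policy /=; apply/asboolP/idP.
Qed.

End ThresholdPath.

(** * Sigma-algebras and independence *)

(** The closure properties are stated for arbitrary families of sets, because
    one sample space carries a different sigma-algebra at every time. *)
Section SigmaAlgebras.
Context (T : Type) (G : set (set T)).
Hypothesis sG : sigma_algebra setT G.
Implicit Types (E F : set T).

Lemma salg0 : G set0. Proof. by case: sG. Qed.

Lemma salgC E : G E -> G (~` E).
Proof. by case: sG => _ + _ => /(_ E); rewrite setTD. Qed.

Lemma salgT : G setT.
Proof. by rewrite -setC0; exact/salgC/salg0. Qed.

Lemma salg_bigcup (I : countType) (D : set I) (F : I -> set T) :
  (forall i, D i -> G (F i)) -> G (\bigcup_(i in D) F i).
Proof.
move=> GF; pose F' k := if unpickle k is Some i then
  (if `[< D i >] then F i else set0) else set0.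
rewrite (_ : \bigcup_(i in D) F i = \bigcup_k F' k); last first.
  apply/seteqP; split=> w [i Di Fw].
    by exists (pickle i) => //; rewrite /F' pickleK asboolT.
  move: Fw; rewrite /F'; case: unpickle => [j|//].
  by case: asboolP => // Dj Fw; exists j.
case: sG => G0 _; apply=> k; rewrite /F'; case: unpickle => [j|//].
by case: asboolP => // /GF.
Qed.

Lemma salgU E F : G E -> G F -> G (E `|` F).
Proof.
move=> GE GF; rewrite (_ : _ `|` _ = \bigcup_b (if b then E else F)).
  by apply: salg_bigcup => -[].
apply/seteqP; split=> [w [h|h]|w [[] _ h]]; [exists true|exists false|left|right] => //.
Qed.

Lemma salgI E F : G E -> G F -> G (E `&` F).
Proof.
move=> GE GF; rewrite -(setCK (E `&` F)) setCI.
by apply: salgC; apply: salgU; apply: salgC.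
Qed.

Lemma salg_fibres (C : countType) (Z : T -> C) (B : set C) :
  (forall c, G [set w | Z w = c]) -> G [set w | B (Z w)].
Proof.
move=> GZ; rewrite (_ : [set _ | _] = \bigcup_(c in B) [set w | Z w = c]).
  by apply: salg_bigcup.
by apply/seteqP; split=> [w Bw|w [k Bk /= ->]//]; exists (Z w).
Qed.

Lemma salg_bool (Z : T -> bool) (B : set bool) : G [set w | Z w] -> G [set w | B (Z w)].
Proof.
move=> GZ; apply: salg_fibres => -[] //.
rewrite (_ : [set _ | _] = ~` [set w | Z w]); first exact: salgC.
by apply/seteqP; split=> w /= => [->|/negP/negbTE].
Qed.

End SigmaAlgebras.

Lemma gen_salg T (G : set (set T)) : sigma_algebra setT <<s G >>.
Proof. exact: smallest_sigma_algebra. Qed.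

Section PiLambda.
Context (R : realType) (d : measure_display) (T : measurableType d).
Variables (P : probability T R) (G : set (set T)) (E0 : set T) (c : R).
Hypotheses (GI : setI_closed G) (mG : G `<=` measurable) (mE0 : measurable E0).
Hypotheses (PE0 : P E0 = c%:E) (PG : forall E, G E -> P (E `&` E0) = (c%:E * P E)%E).

(** The events that satisfy the product rule with [E0] form a Dynkin system. *)
Lemma pi_lambda_independence E : <<s G >> E ->
  measurable E /\ P (E `&` E0) = (c%:E * P E)%E.
Proof.
rewrite -setI_closed_g_dynkin_g_sigma_algebra //.
have PfinT F : measurable F -> P F \is a fin_num by move=> mF; exact: fin_num_measure.
move=> /(_ [set F | measurable F /\ P (F `&` E0) = (c%:E * P F)%E]); apply; split.
  split.
  - by split; rewrite // setTI probability_setT mule1.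
  - move=> F [mF PF]; split; first exact: measurableC.
    have -> : P (~` F `&` E0) = (P E0 - P (F `&` E0))%E.
      by rewrite setIC -setDE measureD // ?ltey_eq ?PfinT // (setIC E0 F).
    rewrite PF PE0.
    rewrite probability_setC // -(fineK (PfinT _ mF)) -EFinM -!EFinB -EFinM.
    by rewrite mulrBr mulr1.
  - move=> F tF FP; have mF k : measurable (F k) by case: (FP k).
    split; first exact: bigcupT_measurable.
    rewrite setI_bigcupl !measure_bigcup //=; last 2 first.
    + by move=> k _; exact: measurableI.
    + by under eq_fun do rewrite setIC; exact: trivIset_setIl.
    rewrite -nneseriesZl //.
    by apply: eq_eseriesr => k _; case: (FP k).
by move=> F GF; split; [exact: mG|exact: PG].
Qed.

End PiLambda.

Lemma probability_bigcup (R : realType) (d : measure_display) (T : measurableType d)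
    (P : probability T R) (F : nat -> set T) :
  (forall k, measurable (F k)) -> trivIset setT F ->
  P (\bigcup_k F k) = (\sum_(k <oo) P (F k))%E.
Proof.
move=> mF tF; rewrite measure_bigcup //.
by apply: eq_eseriesl => k; rewrite in_setT.
Qed.

(** * Event times of a sample path *)

Section RegularPaths.
Context (R : realType).
Implicit Types (x : epath R) (f : R -> nat) (s t u : R) (n k : nat).

Definition counting_path f : Prop :=
  [/\ f 0 = 0%N, (forall s t, 0 <= s -> s <= t -> (f s <= f t)%N) &
      forall t, 0 <= t -> \forall s \near t^'+, f s = f t].

Definition regular_path x : Prop :=
  counting_path (arrivals x) /\ counting_path (tokens x).

Definition events x t : nat := (arrivals x t + tokens x t)%N.

Lemma counting_path_right f t : counting_path f -> 0 <= t ->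
  exists2 e, 0 < e & forall s, t <= s < t + e -> f s = f t.
Proof.
move=> [_ _ rc] t0; have /nbhs_ballP[e /= e0 He] := rc t t0.
exists e => // s /andP[]; rewrite le_eqVlt => /predU1P[<-//|ts] se.
apply: He => //=; rewrite /ball/= ltr_distlC; apply/andP; split; lra.
Qed.

Lemma events_path x : regular_path x -> counting_path (events x).
Proof.
move=> [[A0 Am Ar] [S0 Sm Sr]]; split; rewrite /events.
- by rewrite A0 S0.
- by move=> s t s0 st; rewrite leq_add ?Am ?Sm.
- move=> t t0; have := Ar t t0; have := Sr t t0.
  by apply: filterS2 => s -> ->.
Qed.

(** Right-continuity makes the infimum defining the event time a minimum. *)
Lemma event_time_le x n t : regular_path x -> 0 <= t ->
  (event_time x n <= t%:E)%E = (n <= events x t)%N.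
Proof.
move=> /events_path rx t0; apply/idP/idP => [h|h]; last first.
  by apply: ereal_inf_lbound; exists t.
rewrite leqNgt; apply/negP => Nt.
have [e e0 He] := counting_path_right rx t0.
have [_ mono _] := rx.
suff : ((t + e / 2)%:E <= event_time x n)%E.
  by move=> /le_trans/(_ h); rewrite lee_fin; lra.
apply: le_ereal_inf_tmp => _ [u [u0 nu] <-]; rewrite lee_fin leNgt; apply/negP => ut.
have : (events x u <= events x t)%N.
  rewrite -(He (t + e / 2)); last by apply/andP; split; lra.
  by apply: mono => //; exact: ltW.
by move/(leq_trans nu); rewrite leqNgt Nt.
Qed.

Lemma event_time_fin x n t : regular_path x -> 0 <= t -> (n <= events x t)%N ->
  exists u, [/\ event_time x n = u%:E, 0 <= u, u <= t, (n <= events x u)%N &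
    forall v, 0 <= v -> (n <= events x v)%N -> u <= v].
Proof.
move=> rx t0 nt; have ht : (event_time x n <= t%:E)%E by rewrite event_time_le.
have h0 : (0 <= event_time x n)%E.
  by apply: le_ereal_inf_tmp => _ [u [u0 _] <-]; rewrite lee_fin.
case E : (event_time x n) h0 ht => [u| |] //.
rewrite !lee_fin => u0 ut; exists u; split => //.
  by rewrite -event_time_le // E.
by move=> v v0; rewrite -event_time_le // E lee_fin.
Qed.

(** The count at an event time involves uncountably many times. Paths being
    right-continuous and nondecreasing, it suffices to look at [t] itself and at
    rational times, over which countable unions can be taken. *)
Lemma count_event_time_le x f n t j : regular_path x -> counting_path f -> 0 <= t ->
  (n <= events x t)%N ->
  (f (fine (event_time x n)) <= j)%N <->
  exists s, [/\ s = t \/ exists q : rat, s = ratr q, 0 <= s <= t,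
    (n <= events x s)%N & (f s <= j)%N].
Proof.
move=> rx cf t0 nt; have [u [-> u0 ut nu umin]] := event_time_fin rx t0 nt.
have [_ fmono _] := cf; have [_ Nmono _] := events_path rx.
rewrite /=; split=> [fu|[s [_ /andP[s0 st] ns fs]]]; last first.
  by apply: leq_trans fs; apply: fmono => //; exact: umin.
move: ut; rewrite le_eqVlt => /predU1P[ut|ut].
  by exists t; rewrite -ut; split => //; [left|rewrite u0 lexx].
have [e e0 He] := counting_path_right cf u0.
have [q] := @rat_in_itvoo R u (Num.min (u + e) t) ltac:(rewrite lt_min ut andbT; lra).
rewrite in_itv /= lt_min => /and3P[uq qe qt].
exists (ratr q); split.
- by right; exists q.
- by rewrite (le_trans u0 (ltW uq)) ltW.
- by apply: leq_trans nu _; apply: Nmono => //; exact: ltW.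
- by rewrite He // ltW.
Qed.

(** The type of event [n.+1] can be read off from any interval that contains it
    but not event [n], provided that only one of the two counts moves. *)
Lemma next_event x n s s' : regular_path x -> 0 <= s <= s' ->
  events x s = n -> (n < events x s')%N ->
  (tokens x s = tokens x s' -> event_is_arrival x n.+1) /\
  (arrivals x s = arrivals x s' -> ~~ event_is_arrival x n.+1).
Proof.
move=> rx /andP[s0 ss'] Ns Ns'; have s'0 := le_trans s0 ss'.
have [|u [Tu u0 us nu _]] := @event_time_fin x n s rx s0; first by rewrite Ns.
have [v [Tv v0 vs' nv _]] := @event_time_fin x n.+1 s' rx s'0 Ns'.
have [_ Nmono _] := events_path rx.
have sv : s <= v.
  rewrite leNgt; apply/negP => /ltW vs.
  by have := Nmono _ _ v0 vs; rewrite Ns => /(leq_trans nv); rewrite ltnn.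
have [[_ Am _] [_ Sm _]] := rx.
have := (Am _ _ u0 us, Sm _ _ u0 us, Am _ _ s0 sv, Sm _ _ s0 sv, Am _ _ v0 vs', Sm _ _ v0 vs').
rewrite /event_is_arrival /= Tu Tv /=; move: Ns nu nv; rewrite /events.
by move=> Ns nu nv [[[[[h1 h2] h3] h4] h5] h6]; split; lia.
Qed.

End RegularPaths.

(** * Independence of Poisson increments from the past *)

Section PoissonIncrements.
Context (R : realType) (d : measure_display) (T : measurableType d).
Variables (P : probability T R) (rate : R) (N : R -> T -> nat).
Hypothesis HN : poisson_process P rate N.
Implicit Types (J : seq (R * nat)) (s t : R) (B : set nat).

Lemma measurable_count t B : 0 <= t -> measurable [set w | B (N t w)].
Proof.
move=> t0; rewrite (_ : [set _ | _] = \bigcup_(k in B) [set w | N t w = k]).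
  by apply: bigcup_measurable => k _; exact: (poisson_measurable HN).
by apply/seteqP; split=> [w Bw|w [k Bk /= ->]//]; exists (N t w).
Qed.

Lemma count_incr_events s t B : 0 <= s -> 0 <= t ->
  <<s process_events N [set t | 0 <= t] >> [set w | B (N t w - N s w)%N].
Proof.
move=> s0 t0.
rewrite (_ : [set _ | _] = \bigcup_j ([set w | N s w = j] `&`
    [set w | B (N t w - j)%N])).
  apply: (salg_bigcup (gen_salg _)) => j _.
  by apply: (salgI (gen_salg _)) => //; apply: sub_sigma_algebra;
    [exists s, [set j]|exists t, [set k | B (k - j)%N]].
by apply/seteqP; split=> [w Bw|w [j _ [/= <-]]//]; exists (N s w).
Qed.

Definition cylinder J : set T := [set w | forall tk, tk \in J -> N tk.1 w = tk.2].

Lemma cylinder_events J : all (fun tk => 0 <= tk.1) J ->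
  <<s process_events N [set t | 0 <= t] >> (cylinder J).
Proof.
elim: J => [_|[t k] J IH /= /andP[t0 /IH sJ]].
  rewrite (_ : cylinder [::] = setT); first exact: (salgT (gen_salg _)).
  by apply/seteqP.
rewrite (_ : cylinder _ = [set w | N t w = k] `&` cylinder J).
  by apply: (salgI (gen_salg _)) => //; apply: sub_sigma_algebra; exists t, [set k].
apply/seteqP; split=> [w h|w [h1 h2] tk]; last first.
  by rewrite in_cons => /predU1P[->//|/h2].
split; first by apply: (h (t, k)); rewrite mem_head.
by move=> tk tkJ; apply: h; rewrite in_cons tkJ orbT.
Qed.

(** With the times sorted, the values prescribed on a nonempty cylinder are
    equivalent to those of the increments over consecutive intervals, read off
    from any of its points [w0]; the independence of increments then applies. *)
Lemma cylinder_indep J s s' B : all (fun tk => 0 <= tk.1 <= s) J -> 0 <= s -> s <= s' ->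
  P (cylinder J `&` [set w | B (N s' w - N s w)%N]) =
  (P (cylinder J) * P [set w | B (N s' w - N s w)%N])%E.
Proof.
move=> Js s0 ss'.
have [->|/set0P[w0 Jw0]] := eqVneq (cylinder J) set0.
  by rewrite set0I measure0 mul0e.
pose l := rcons (sort <=%R (map fst J)) s.
pose n := (size J).+1.
pose t i := nth s' (0 :: l) i.
have sl : size l = n by rewrite /l size_rcons size_sort size_map.
have pl : path <=%R 0 l.
  rewrite /l rcons_path; apply/andP; split.
    rewrite path_sortedE; last exact: le_trans.
    rewrite sort_sorted ?andbT; last exact: le_total.
    by rewrite all_sort all_map; apply: sub_all Js => tk /= /andP[].
  have : last 0 (sort <=%R [seq i.1 | i <- J]) \in 0 :: sort <=%R (map fst J).
    exact: mem_last.
  rewrite in_cons mem_sort => /predU1P[->//|/mapP[tk tkJ ->]].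
  by have /allP/(_ _ tkJ)/andP[] := Js.
have tmono i : t i <= t i.+1.
  have [il|] := ltnP i (size l); first by have /(pathP s')/(_ _ il) := pl.
  rewrite leq_eqVlt => /predU1P[<-|li].
    rewrite /t /= [nth _ l _]nth_default // /l size_rcons /=.
    by rewrite nth_rcons ltnn eqxx.
  by rewrite /t !nth_default //= ltnW.
have tn : t n = s by rewrite /t -sl /l size_rcons /= nth_rcons ltnn eqxx.
have tn1 : t n.+1 = s' by rewrite /t nth_default //= sl.
have t0 : t 0%N = 0 by [].
have tge0 i : 0 <= t i by elim: i => [|i IH]; rewrite ?t0 // (le_trans IH).
pose m := size J.
(* The interval from the last prescribed time to [s] is left unconstrained. *)
pose B' i := if (i < m)%N then [set (N (t i.+1) w0 - N (t i) w0)%N]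
  else if i == m then setT else B.
pose F i := [set w | B' i (N (t i.+1) w - N (t i) w)%N].
have cylE : cylinder J = \bigcap_(i < m) F i.
  have memJ u : u \in map fst J -> exists2 i, (i < m)%N & t i.+1 = u.
    rewrite -(mem_sort <=%R) => uJ; exists (index u (sort <=%R (map fst J))).
      by rewrite /m -(size_map fst) -(size_sort <=%R) index_mem.
    by rewrite /t /l /= nth_rcons index_mem uJ nth_index.
  apply/seteqP; split=> w Jw.
    have eqJ u : u \in map fst J -> N u w = N u w0.
      by move=> /mapP[tk tkJ ->]; rewrite Jw // Jw0.
    have eqt i : (i <= m)%N -> N (t i) w = N (t i) w0.
      case: i => [_|i i_m]; first by rewrite t0 !(poisson_start HN).
      apply: eqJ; rewrite /t /= /l nth_rcons size_sort size_map i_m.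
      by rewrite -(mem_sort <=%R) mem_nth // size_sort size_map.
    by move=> i /= i_m; rewrite /F /B' /= i_m /= !eqt // ltnW.
  have eqt i : (i <= m)%N -> N (t i) w = N (t i) w0.
    elim: i => [_|i IH i_m]; first by rewrite t0 !(poisson_start HN).
    have := Jw i i_m; rewrite /F /= /B' i_m /=.
    have := poisson_nondecreasing HN w (tge0 i) (tmono i).
    have := poisson_nondecreasing HN w0 (tge0 i) (tmono i).
    by rewrite IH ?(ltnW i_m) //; lia.
  move=> tk tkJ; have [i i_m ti] := memJ _ (map_f fst tkJ).
  by rewrite -ti eqt // ti Jw0.
have FT : F m = setT by rewrite /F /B' ltnn eqxx.
have FB : F m.+1 = [set w | B (N s' w - N s w)%N].
  by rewrite /F /B' ltnNge leqnSn /= gtn_eqF // tn tn1.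
have capE : cylinder J `&` [set w | B (N s' w - N s w)%N] = \bigcap_(i < m.+2) F i.
  rewrite cylE -FB; apply/seteqP; split=> [w [h1 h2] i /=|w h].
    rewrite ltnS leq_eqVlt => /predU1P[->//|].
    by rewrite ltnS leq_eqVlt => /predU1P[->//|]; [rewrite FT|exact: h1].
  by split=> [i /= im|]; apply: h => //=; rewrite ltnW // ltnW.
have PF k : P (\bigcap_(i < k) F i) = (\prod_(i < k) P (F i))%E.
  by apply: (@poisson_independent_increments _ _ _ _ _ _ HN k t B'); rewrite ?t0.
by rewrite capE cylE !PF !big_ord_recr /= FB FT probability_setT mule1.
Qed.

End PoissonIncrements.

(** * Short and long time estimates for Poisson processes *)

Section PoissonProbabilities.
Context (R : realType) (d : measure_display) (T : measurableType d).
Variables (P : probability T R) (rate : R) (N : R -> T -> nat).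
Hypothesis (rate0 : 0 < rate).
Hypothesis HN : poisson_process P rate N.
Implicit Types (s t : R).

Let incr s t (B : set nat) := [set w | B (N t w - N s w)%N].

Lemma measurable_incr s t B : 0 <= s -> 0 <= t -> measurable (incr s t B).
Proof.
move=> s0 t0; have := count_incr_events (N := N) B s0 t0.
apply: smallest_sub; first exact: sigma_algebra_measurable.
by move=> _ [u [C [u0 ->]]]; exact: (measurable_count HN).
Qed.

Lemma incr_eq0 s t : 0 <= s -> s < t ->
  P (incr s t [set 0%N]) = (expR (- (rate * (t - s))))%:E.
Proof.
move=> s0 st; rewrite /incr (poisson_increments HN) // /poisson_pmf.
by rewrite mulr_gt0 ?subr_gt0 // expr0 fact0 invr1 !mul1r.
Qed.

Lemma incr_ge1 s t : 0 <= s -> s < t ->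
  P (incr s t [set k | (0 < k)%N]) = (1 - expR (- (rate * (t - s))))%:E.
Proof.
move=> s0 st; have t0 := le_trans s0 (ltW st).
rewrite (_ : incr _ _ _ = ~` incr s t [set 0%N]); last first.
  by apply/seteqP; split=> w; rewrite /incr /= lt0n => /eqP.
by rewrite probability_setC ?incr_eq0 //; exact: measurable_incr.
Qed.

Lemma incr_ge1_le s t : 0 <= s -> s < t ->
  (P (incr s t [set k | (0 < k)%N]) <= (rate * (t - s))%:E)%E.
Proof.
move=> s0 st; rewrite incr_ge1 // lee_fin.
by have := expR_ge1Dx (- (rate * (t - s))); lra.
Qed.

Lemma incr_ge2_le s t : 0 <= s -> s < t ->
  (P (incr s t [set k | (1 < k)%N]) <= ((rate * (t - s)) ^+ 2)%:E)%E.
Proof.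
move=> s0 st; have t0 := le_trans s0 (ltW st).
rewrite (_ : incr _ _ _ = ~` (incr s t [set 0%N] `|` incr s t [set 1%N])); last first.
  by apply/seteqP; split=> w; rewrite /incr /=; case: (_ - _)%N => [|[|k]] // h; first [by case | by case: h; auto].
rewrite probability_setC; last by apply: measurableU; exact: measurable_incr.
have -> : P (incr s t [set 0%N] `|` incr s t [set 1%N]) =
    (P (incr s t [set 0%N]) + P (incr s t [set 1%N]))%E.
  apply: measureU; [exact: measurable_incr|exact: measurable_incr|].
  by apply/seteqP; split=> w //=; rewrite /incr /= => -[->].
rewrite incr_eq0 // [P (incr s t [set 1%N])](poisson_increments HN) // /poisson_pmf.
rewrite mulr_gt0 ?subr_gt0 // expr1 (_ : 1`! = 1%N) // invr1 mulr1 -!EFinD lee_fin.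
set x := rate * _; have := expR_ge1Dx (- x).
have x0 : 0 < x by rewrite mulr_gt0 ?subr_gt0.
move=> h; have : (1 - x) * (1 + x) <= expR (- x) * (1 + x) by apply: ler_wpM2r => //; lra.
by rewrite expr2; lra.
Qed.

(** As exp x >= (x / (j + 1)) ^ (j + 1), the Poisson weight of j is of order
    1 / x at most. *)
Lemma count_le t n : 0 < t ->
  (P [set w | (N t w <= n)%N] <= \sum_(j < n.+1) ((j.+1%:R ^+ j.+1) / (rate * t))%:E)%E.
Proof.
move=> t0; have rt : 0 < rate * t by rewrite mulr_gt0.
rewrite (_ : [set _ | _] = \big[setU/set0]_(j < n.+1) [set w | N t w = j]); last first.
  rewrite -(bigcup_mkord n.+1 (fun j => [set w | N t w = j])).
  apply/seteqP; split=> w /=.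
    by move=> h; exists (N t w).
  by move=> [j /= jn ->].
apply: le_trans (_ : (\sum_(j < n.+1) P [set w | N t w = j] <= _)%E).
  apply: (@Boole_inequality _ _ _ P (fun j => [set w | N t w = j]) n.+1).
  by move=> i _; exact: (poisson_measurable HN) (ltW t0).
apply: lee_sum => j _.
have -> : [set w | N t w = j] = [set w | (N t w - N 0 w)%N = j].
  by apply/seteqP; split=> w /=; rewrite (poisson_start HN) subn0.
rewrite (poisson_increments HN) // subr0 /poisson_pmf rt lee_fin.
set x := rate * t in rt *; set k := (nat_of_ord j).
have k1 : 0 < k.+1%:R :> R by [].
have h1 : 1 + x / k.+1%:R <= expR (x / k.+1%:R) by exact: expR_ge1Dx.
have h2 : (x / k.+1%:R) ^+ k.+1 <= expR x.
  have -> : expR x = expR (x / k.+1%:R) ^+ k.+1.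
    by rewrite -expRM_natr mulfVK // gt_eqF.
  apply: lerXn2r; rewrite ?nnegrE ?expR_ge0 ?divr_ge0 ?(ltW rt) //.
    by apply: le_trans h1; rewrite lerDr.
have f0 : k`!%:R^-1 <= 1 :> R by rewrite invf_le1 ?ltr0n ?fact_gt0 // ler1n fact_gt0.
move: h2; rewrite expr_div_n ler_pdivrMr ?exprn_gt0 // => h2.
rewrite expRN ler_pdivlMr // mulrAC ler_pdivrMr ?expR_gt0 //.
apply: le_trans (_ : x ^+ k.+1 <= _); last by rewrite mulrC.
rewrite exprSr ler_pM2r // -[leRHS]mulr1; apply: ler_wpM2l => //.
by rewrite exprn_ge0 // ltW.
Qed.

End PoissonProbabilities.

(** * The information available at event times *)

Section ModelFiltration.
Context (R : realType) (p lam : R) (X : queue_model R).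
Hypothesis V : valid_model p lam X.
Implicit Types (s t h : R) (n k : nat) (E : set (model_space X)).

Local Notation A := (@model_arrivals R X).
Local Notation S := (@model_tokens R X).
Local Notation P := (model_law X).
Local Notation path_of o := (@sample_path R X o).
Local Notation Ft := (@filtration R X).

Let HA := valid_arrivals V.
Let HS := valid_tokens V.

Lemma sample_path_regular (o : model_space X) : regular_path (path_of o).
Proof.
split; split=> /=.
- exact: (poisson_start HA).
- exact: (poisson_nondecreasing HA).
- exact: (poisson_right_continuous HA).
- exact: (poisson_start HS).
- exact: (poisson_nondecreasing HS).
- exact: (poisson_right_continuous HS).
Qed.

Lemma filtration_measurable t : Ft t `<=` measurable.
Proof.
apply: smallest_sub; first exact: sigma_algebra_measurable.
move=> _ [[s [B [/andP[s0 _] ->]]]|[s [B [/andP[s0 _] ->]]]].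
  exact: (measurable_count HA).
exact: (measurable_count HS).
Qed.

Lemma filtration_oo_measurable : @filtration_oo R X `<=` measurable.
Proof.
apply: smallest_sub; first exact: sigma_algebra_measurable.
by move=> E [t _]; exact: filtration_measurable.
Qed.

Lemma filtration_sub_oo t : 0 <= t -> Ft t `<=` @filtration_oo R X.
Proof. by move=> t0 E FE; apply: sub_sigma_algebra; exists t. Qed.

Lemma filtration_arrivals s t (B : set nat) : 0 <= s <= t -> Ft t [set o | B (A s o)].
Proof. by move=> st; apply: sub_sigma_algebra; left; exists s, B. Qed.

Lemma filtration_tokens s t (B : set nat) : 0 <= s <= t -> Ft t [set o | B (S s o)].
Proof. by move=> st; apply: sub_sigma_algebra; right; exists s, B. Qed.

Lemma filtration_events s t (B : set nat) : 0 <= s <= t ->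
  Ft t [set o | B (events (path_of o) s)].
Proof.
move=> st; apply: (@salg_fibres _ _ (gen_salg _) _ (fun o => events (path_of o) s)) => c.
have sF : sigma_algebra setT (Ft t) by exact: gen_salg.
rewrite (_ : [set _ | _] = \bigcup_j ([set o | A s o = j] `&` [set o | (j + S s o = c)%N])).
  apply: (salg_bigcup sF) => j _; apply: (salgI sF).
    exact: (@filtration_arrivals s t [set j]).
  exact: (@filtration_tokens s t [set m | (j + m = c)%N]).
by apply/seteqP; split=> [w /= <- | w [j _ [/= <- <-]]] //; exists (A s w).
Qed.

Lemma filtration_event_time n t : 0 <= t ->
  Ft t [set o | (event_time (path_of o) n <= t%:E)%E].
Proof.
move=> t0; rewrite (_ : [set _ | _] = [set o | (n <= events (path_of o) t)%N]).
  by apply: (@filtration_events t t [set m | (n <= m)%N]); rewrite t0 lexx.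
by apply/seteqP; split=> o /=; rewrite event_time_le //; exact: sample_path_regular.
Qed.

(** The sigma-algebra stopped at the n-th event time. *)
Definition event_history n : set (set (model_space X)) :=
  filtration_at (fun o => event_time (path_of o) n).

Lemma event_history_salg n : sigma_algebra setT (event_history n).
Proof.
have sF t : sigma_algebra setT (Ft t) by exact: gen_salg.
have so : sigma_algebra setT (@filtration_oo R X) by exact: gen_salg.
split.
- by split; [exact: salg0|move=> t t0; rewrite set0I; exact: salg0].
- move=> E [oE FE]; rewrite setTD; split; first exact: (salgC so).
  move=> t t0; set Z := [set o | _].
  rewrite (_ : _ `&` _ = Z `&` ~` (E `&` Z)).
    by apply: (salgI (sF t)); [exact: filtration_event_time|apply: (salgC (sF t)); exact: FE].
  apply/seteqP; split=> o [h1 h2]; split => //; first by case.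
  by move=> h3; apply: h2.
- move=> E HE; split; first by apply: (salg_bigcup so) => i _; case: (HE i).
  by move=> t t0; rewrite setI_bigcupl; apply: (salg_bigcup (sF t)) => i _; case: (HE i) => _; exact.
Qed.

Lemma event_history_mono n n' : (n <= n')%N -> event_history n `<=` event_history n'.
Proof.
move=> nn' E [oE FE]; split => // t t0.
rewrite (_ : _ `&` _ = (E `&` [set o | (event_time (path_of o) n <= t%:E)%E]) `&`
  [set o | (event_time (path_of o) n' <= t%:E)%E]).
  by apply: (salgI (gen_salg _)); [exact: FE|exact: filtration_event_time].
apply/seteqP; split=> [w [h1 h2]|w [[h1 _] h2]]; last by split.
split=> //; split=> //=; move: h2; rewrite /= !event_time_le //; try exact: sample_path_regular.
exact: leq_trans.
Qed.

Lemma event_history_measurable n : event_history n `<=` measurable.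
Proof. by move=> E [/filtration_oo_measurable]. Qed.

(** Up to time [t] this is [count_event_time_le]. On the event that fewer than
    [n] events ever happen, the infinite event time is read as 0, when the count
    is 0. *)
Lemma event_history_arrivals n j :
  event_history n [set o | (A (fine (event_time (path_of o) n)) o <= j)%N].
Proof.
set E := [set o | _].
have HF t : 0 <= t -> Ft t (E `&` [set o | (event_time (path_of o) n <= t%:E)%E]).
  move=> t0; have sF : sigma_algebra setT (Ft t) by exact: gen_salg.
  pose G s := if `[< 0 <= s <= t >] then
    [set o | (n <= events (path_of o) s)%N] `&` [set o | (A s o <= j)%N] else set0.
  have FG s : Ft t (G s).
    rewrite /G; case: asboolP => st; last exact: salg0.
    apply: (salgI sF); first exact: (@filtration_events s t [set m | (n <= m)%N]).
    exact: (@filtration_arrivals s t [set m | (m <= j)%N]).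
  rewrite (_ : _ `&` _ = [set o | (event_time (path_of o) n <= t%:E)%E] `&`
      (G t `|` \bigcup_(q in [set: rat]) G (ratr q))).
    apply: (salgI sF); first exact: filtration_event_time.
    by apply: (salgU sF) => //; exact: (salg_bigcup sF).
  have ro := sample_path_regular.
  have iffE o : (event_time (path_of o) n <= t%:E)%E -> E o <->
    exists s, [/\ s = t \/ exists q : rat, s = ratr q, 0 <= s <= t,
      (n <= events (path_of o) s)%N & (A s o <= j)%N].
    rewrite event_time_le // => nt; have [rA _] := ro o.
    exact: (count_event_time_le j (ro o) rA t0 nt).
  apply/seteqP; split=> o.
    move=> [Eo To]; split => //; have [/(_ Eo)[s [st s0 ns As]] _] := iffE o To.
    by case: st => [st|[q sq]]; [left; rewrite -st|right; exists q => //; rewrite -sq];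
      rewrite /G asboolT.
  move=> [To Go]; split => //; apply/(iffE o To).
  by case: Go => [|[q _]]; rewrite /G; case: asboolP => // st [h1 h2];
    [exists t; split => //; left|exists (ratr q); split => //; right; exists q].
split; last exact: HF.
have so : sigma_algebra setT (@filtration_oo R X) by exact: gen_salg.
pose Z := \bigcup_(k : nat) [set o | (event_time (path_of o) n <= k%:R%:E)%E].
have oZ : filtration_oo Z.
  by apply: (salg_bigcup so) => k _; exact: (filtration_sub_oo (ler0n R k) (filtration_event_time _ (ler0n R k))).
rewrite (_ : E = (\bigcup_(k : nat) (E `&` [set o | (event_time (path_of o) n <= k%:R%:E)%E]))
   `|` ~` Z).
  apply: (salgU so); last exact: (salgC so).
  by apply: (salg_bigcup so) => k _; exact: (filtration_sub_oo (ler0n R k) (HF _ (ler0n R k))).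
rewrite -setI_bigcupr -/Z; apply/seteqP; split=> o.
  by move=> Eo; have [Zo|nZo] := pselect (Z o); [left|right].
case=> [[]//|nZ]; have T0 : (0 <= event_time (path_of o) n)%E.
  by apply: le_ereal_inf_tmp => _ [u [u0 _] <-]; rewrite lee_fin.
rewrite /E /=; case Eu : (event_time _ _) T0 => [u| |] //=; last by rewrite (poisson_start HA).
move=> u0; exfalso; apply: nZ; exists (Num.truncn u).+1 => //=.
by rewrite Eu lee_fin ltW // truncnS_gt.
Qed.

Lemma event_history_is_arrival n : (0 < n)%N ->
  event_history n [set o | event_is_arrival (path_of o) n].
Proof.
case: n => // n _; have sH := event_history_salg n.+1.
pose H k j := [set o | (A (fine (event_time (path_of o) k)) o <= j)%N].
rewrite (_ : [set _ | _] = \bigcup_j (H n j `&` ~` H n.+1 j)).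
  apply: (salg_bigcup sH) => j _; apply: (salgI sH).
    by apply: (event_history_mono (leqnSn n)); exact: event_history_arrivals.
  by apply: (salgC sH); exact: event_history_arrivals.
rewrite /event_is_arrival /H /=; apply/seteqP; split=> o /=.
  by move=> h; exists (A (fine (event_time (path_of o) n)) o) => //; split => //=; lia.
by case=> j _ [/=]; lia.
Qed.

End ModelFiltration.

(** * The type of the next event is independent of the past *)

Section NextEventType.
Context (R : realType) (p lam : R) (X : queue_model R).
Hypothesis V : valid_model p lam X.
Hypotheses (hp : 0 < p < 1) (hlam : 0 < lam < 1).
Implicit Types (s t h : R) (n k : nat) (E : set (model_space X)).

Local Notation A := (@model_arrivals R X).
Local Notation S := (@model_tokens R X).
Local Notation P := (model_law X).
Local Notation path_of o := (@sample_path R X o).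
Local Notation Ft := (@filtration R X).

Let HA := valid_arrivals V.
Let HS := valid_tokens V.
Let incr (N : R -> model_space X -> nat) s t (B : set nat) :=
  [set o | B (N t o - N s o)%N].

Let mincrA s t B : 0 <= s -> 0 <= t -> measurable (incr A s t B).
Proof. exact: (measurable_incr HA). Qed.

Let mincrS s t B : 0 <= s -> 0 <= t -> measurable (incr S s t B).
Proof. exact: (measurable_incr HS). Qed.

Lemma incr_indep s t B C : 0 <= s -> 0 <= t ->
  P (incr A s t B `&` incr S s t C) = (P (incr A s t B) * P (incr S s t C))%E.
Proof. by move=> s0 t0; apply: (valid_independent V); exact: count_incr_events. Qed.

Lemma cylinder_cat (N : R -> model_space X -> nat) J J' :
  cylinder N (J ++ J') = cylinder N J `&` cylinder N J'.
Proof.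
apply/seteqP; split=> w; last first.
  by move=> [h1 h2] tk; rewrite mem_cat => /orP[/h1|/h2].
by move=> h; split=> tk tkJ; apply: h; rewrite mem_cat tkJ ?orbT.
Qed.

(** Finite-dimensional cylinders of both processes form a pi-system generating the
    past, on which independence holds within each process and between the two. *)
Lemma filtration_indep s t B C E : 0 <= s -> s <= t -> Ft s E ->
  P (E `&` (incr A s t B `&` incr S s t C)) =
  (P (incr A s t B `&` incr S s t C) * P E)%E.
Proof.
move=> s0 st; have t0 := le_trans s0 st.
set I := incr A s t B `&` incr S s t C.
have mI : measurable I by apply: measurableI; [exact: mincrA|exact: mincrS].
have fI : P I \is a fin_num by exact: fin_num_measure.
pose ok J := all (fun tk : R * nat => 0 <= tk.1 <= s) J.
pose G := [set E | exists J J', [/\ ok J, ok J' & E = cylinder A J `&` cylinder S J']].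
have ok0 J : ok J -> all (fun tk : R * nat => 0 <= tk.1) J.
  by apply: sub_all => tk /andP[].
have mcylA J : ok J -> measurable (cylinder A J).
  move=> /ok0 /(cylinder_events (N := A)); apply: smallest_sub; first exact: sigma_algebra_measurable.
  by move=> _ [u [D [u0 ->]]]; exact: (measurable_count HA).
have mcylS J : ok J -> measurable (cylinder S J).
  move=> /ok0 /(cylinder_events (N := S)); apply: smallest_sub; first exact: sigma_algebra_measurable.
  by move=> _ [u [D [u0 ->]]]; exact: (measurable_count HS).
have GF : Ft s `<=` <<s G >>.
  apply: smallest_sub; first exact: gen_salg.
  have GA u k : 0 <= u <= s -> G [set o | A u o = k].
    move=> us; exists [:: (u, k)], [::]; split; rewrite /ok /= ?us //.
    apply/seteqP; split=> w /=.
      by move=> h; split=> // tk; rewrite mem_seq1 => /eqP ->.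
    by move=> [h _]; apply: (h (u, k)); rewrite mem_head.
  have GS u k : 0 <= u <= s -> G [set o | S u o = k].
    move=> us; exists [::], [:: (u, k)]; split; rewrite /ok /= ?us //.
    apply/seteqP; split=> w /=.
      by move=> h; split=> // tk; rewrite mem_seq1 => /eqP ->.
    by move=> [_ h]; apply: (h (u, k)); rewrite mem_head.
  move=> _ [[u [D [us ->]]]|[u [D [us ->]]]].
    apply: (@salg_fibres _ _ (gen_salg _) _ (fun o => A u o)) => c.
    by apply: sub_sigma_algebra; exact: GA.
  apply: (@salg_fibres _ _ (gen_salg _) _ (fun o => S u o)) => c.
  by apply: sub_sigma_algebra; exact: GS.
move=> /GF GE; rewrite -(fineK fI).
apply: (proj2 (@pi_lambda_independence _ _ _ P G I (fine (P I)) _ _ mI _ _ E GE)).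
- move=> _ _ [J1 [J1' [ko1 ko1' ->]]] [J2 [J2' [ko2 ko2' ->]]].
  exists (J1 ++ J2), (J1' ++ J2'); rewrite /ok !all_cat -!/(ok _) ko1 ko2 ko1' ko2'; split => //.
  by rewrite !cylinder_cat setIACA.
- by move=> _ [J [J' [koJ koJ' ->]]]; apply: measurableI; [exact: mcylA|exact: mcylS].
- by rewrite fineK.
move=> _ [J [J' [koJ koJ' ->]]]; rewrite fineK // /I setIACA.
rewrite (valid_independent V); last 2 first.
- by apply: (salgI (gen_salg _)); [exact: cylinder_events (ok0 _ _)|exact: count_incr_events].
- by apply: (salgI (gen_salg _)); [exact: cylinder_events (ok0 _ _)|exact: count_incr_events].
rewrite (cylinder_indep HA) // (cylinder_indep HS) // incr_indep //.
rewrite (valid_independent V); [|exact: cylinder_events (ok0 _ _)|exact: cylinder_events (ok0 _ _)].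
by rewrite muleACA muleC.
Qed.

Let mu := lam + 1 - p.
Let p0 : 0 < p. Proof. by case/andP: hp. Qed.
Let p1 : p < 1. Proof. by case/andP: hp. Qed.
Let l0 : 0 < lam. Proof. by case/andP: hlam. Qed.
Let l1 : lam < 1. Proof. by case/andP: hlam. Qed.
Let q0 : 0 < 1 - p. Proof. by rewrite subr_gt0. Qed.
Let mu0 : 0 < mu. Proof. by rewrite /mu -addrA addr_gt0. Qed.

Let separated n h := [set o | exists c : nat,
  events (path_of o) (c%:R * h) = n /\ (n < events (path_of o) (c.+1%:R * h))%N].

(** If the mesh 1 / m does not separate events n and n + 1, then either at most
    n arrivals occur before time K, or one of the K * m cells before K contains
    two events; the latter has probability at most 3 / m ^ 2 for each cell. *)
Lemma separated_bound n (m K : nat) : (0 < m)%N -> (0 < K)%N ->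
  measurable (separated n m%:R^-1) /\
  (P (~` separated n m%:R^-1) <=
   (\sum_(j < n.+1) ((j.+1%:R ^+ j.+1) / (lam * K%:R)) + 3 * K%:R / m%:R)%:E)%E.
Proof.
move=> m0 K0; set h := m%:R^-1.
have h0 : 0 < h by rewrite invr_gt0 ltr0n.
have t0 (c : nat) : 0 <= c%:R * h by rewrite mulr_ge0 // ltW.
have tS (c : nat) : c%:R * h < c.+1%:R * h by rewrite ltr_pM2r // ltr_nat.
have hE (c : nat) : c.+1%:R * h - c%:R * h = h by rewrite -natr1; ring.
have mev t B : 0 <= t -> measurable [set o | B (events (path_of o) t)].
  move=> u0; apply: (@filtration_measurable _ _ _ _ V t).
  by apply: filtration_events; rewrite u0 lexx.
have msep : measurable (separated n h).
  rewrite (_ : separated n h = \bigcup_c ([set o | events (path_of o) (c%:R * h) = n] `&`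
      [set o | (n < events (path_of o) (c.+1%:R * h))%N])).
    apply: bigcupT_measurable => c; apply: measurableI.
      exact: (mev _ [set k | k = n]).
    exact: (mev _ [set k | (n < k)%N]).
  by apply/seteqP; split=> o [c]; [move=> [h1 h2]; exists c|move=> _ [h1 h2]; exists c].
split=> //.
pose B1 c := incr A (c%:R * h) (c.+1%:R * h) [set k | (1 < k)%N].
pose B2 c := incr S (c%:R * h) (c.+1%:R * h) [set k | (1 < k)%N].
pose B3 c := incr A (c%:R * h) (c.+1%:R * h) [set k | (0 < k)%N] `&`
             incr S (c%:R * h) (c.+1%:R * h) [set k | (0 < k)%N].
pose B c := B1 c `|` B2 c `|` B3 c.
have mB c : measurable (B c).
  by apply: measurableU; [apply: measurableU|apply: measurableI];
    (exact: mincrA || exact: mincrS).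
have PB c : (P (B c) <= (3 * h ^+ 2)%:E)%E.
  apply: le_trans (_ : (P (B1 c) + P (B2 c) + P (B3 c) <= _)%E).
    apply: le_trans (measureU2 _ _ _) _.
    - by apply: measurableU; [exact: mincrA|exact: mincrS].
    - by apply: measurableI; [exact: mincrA|exact: mincrS].
    rewrite leeD2r //; apply: measureU2; [exact: mincrA|exact: mincrS].
  have -> : 3 * h ^+ 2 = h ^+ 2 + h ^+ 2 + h ^+ 2 by ring.
  rewrite !EFinD; apply: leeD; first apply: leeD.
  - apply: le_trans (incr_ge2_le l0 HA (t0 c) (tS c)) _.
    by rewrite hE lee_fin lerXn2r ?nnegrE ?mulr_ge0 ?(ltW h0) ?(ltW l0) // ler_piMl ?ltW.
  - apply: le_trans (incr_ge2_le q0 HS (t0 c) (tS c)) _.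
    by rewrite hE lee_fin lerXn2r ?nnegrE ?mulr_ge0 ?(ltW h0) ?(ltW q0) // ler_piMl ?ltW // ltrBlDr ltrDl.
  - rewrite incr_indep //.
    apply: le_trans (lee_pmul _ _ (incr_ge1_le l0 HA (t0 c) (tS c)) (incr_ge1_le q0 HS (t0 c) (tS c))) _ => //.
    rewrite !hE -EFinM lee_fin expr2.
    by apply: ler_pM; rewrite ?mulr_ge0 ?(ltW h0) ?(ltW l0) ?(ltW q0) // ler_piMl ?ltW // ltrBlDr ltrDl.
have sub : ~` separated n h `<=` [set o | (A K%:R o <= n)%N] `|` \big[setU/set0]_(c < K * m) B c.
  move=> o nsep; have [AK|AK] := leqP (A K%:R o) n; [by left|right].
  rewrite -(bigcup_mkord (K * m) B); apply: contrapT => nB.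
  have KmK : (K * m)%:R * h = K%:R by rewrite natrM -mulrA divff ?mulr1 // pnatr_eq0 -lt0n.
  have ex : exists c, (n < events (path_of o) (c%:R * h))%N.
    by exists (K * m)%N; rewrite KmK; exact: leq_trans AK (leq_addr _ _).
  have [_ mono _] := events_path (sample_path_regular V o).
  have [[N00 _ _] _] := sample_path_regular V o.
  have [[|c] Nc minc] := ex_minnP ex.
    by move: Nc; rewrite mul0r /events /= (poisson_start HA) (poisson_start HS).
  have cKm : (c < K * m)%N by apply: minc; rewrite KmK; exact: leq_trans AK (leq_addr _ _).
  have Nc' : (events (path_of o) (c%:R * h) <= n)%N.
    by rewrite leqNgt; apply/negP => /minc; rewrite ltnn.
  apply: nsep; exists c; split => //.
  have : ~ B c o by move=> Bc; apply: nB; exists c.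
  rewrite /B /B1 /B2 /B3 /incr /= => nBc.
  have Am := poisson_nondecreasing HA o (t0 c) (ltW (tS c)).
  have Sm := poisson_nondecreasing HS o (t0 c) (ltW (tS c)).
  move: Nc Nc'; rewrite /events /= => Nc Nc'; apply/eqP; rewrite eqn_leq Nc' /=.
  rewrite leqNgt; apply/negP => Nn; apply: nBc.
  have [a2|a2] := ltnP 1 (A (c.+1%:R * h) o - A (c%:R * h) o)%N; first by left; left.
  have [b2|b2] := ltnP 1 (S (c.+1%:R * h) o - S (c%:R * h) o)%N; first by left; right.
  right; rewrite /=; move: Am Sm Nc Nn a2 b2.
  move: (A (c.+1%:R * h) o) (A (c%:R * h) o) (S (c.+1%:R * h) o) (S (c%:R * h) o).
  by move=> a' a b' b; clear; lia.
apply: le_trans (le_measure P _ _ sub) _; rewrite ?inE.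
- exact: measurableC.
- apply: measurableU; last by apply: bigsetU_measurable.
  exact: (@measurable_count _ _ _ _ _ _ HA K%:R [set k | (k <= n)%N]).
apply: le_trans (measureU2 _ _ _) _.
- exact: (@measurable_count _ _ _ _ _ _ HA K%:R [set k | (k <= n)%N]).
- exact: bigsetU_measurable.
rewrite EFinD; apply: leeD.
  by rewrite -sumEFin; apply: (count_le l0 HA); rewrite ltr0n.
have BI : (P (\big[setU/set0]_(c < K * m) B c) <= \sum_(c < K * m) P (B c))%E.
  exact: Boole_inequality.
apply: (le_trans BI).
have S1 : (\sum_(c < K * m) P (B c) <= \sum_(c < K * m) (3 * h ^+ 2)%:E)%E by apply: lee_sum => c _; exact: PB.
apply: (le_trans S1).
rewrite sumEFin lee_fin sumr_const card_ord -[leLHS]mulr_natl.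
rewrite (_ : (K * m)%N%:R = K%:R * m%:R :> R); last exact: natrM.
rewrite /h expr2.
rewrite le_eqVlt; apply/orP; left; apply/eqP; field.
by rewrite pnatr_eq0 -lt0n.
Qed.

Lemma separated_likely n eps : 0 < eps -> exists M : nat, forall m : nat, (M < m)%N ->
  measurable (separated n m%:R^-1) /\ (P (~` separated n m%:R^-1) <= eps%:E)%E.
Proof.
move=> eps0; pose C : R := \sum_(j < n.+1) (j.+1%:R ^+ j.+1).
have C0 : 0 <= C by apply: sumr_ge0 => j _; exact: exprn_ge0.
have e2 : 0 < eps / 2 by rewrite divr_gt0.
pose K := (Num.truncn (C / lam / (eps / 2))).+1.
have KC : C / lam / K%:R <= eps / 2.
  rewrite ler_pdivrMr ?ltr0n // -ler_pdivrMl // mulrC ltW //.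
  exact: truncnS_gt.
pose M := Num.truncn (3 * K%:R / (eps / 2)).
exists M => m Mm; have m0 : (0 < m)%N by exact: leq_ltn_trans Mm.
have [ms le] := separated_bound n m0 (ltn0Sn _ : (0 < K)%N).
split=> //; apply: le_trans le _; rewrite lee_fin.
have -> : \sum_(j < n.+1) j.+1%:R ^+ j.+1 / (lam * K%:R) = C / lam / K%:R.
  by rewrite -mulr_suml invfM mulrA.
have -> : eps = eps / 2 + eps / 2 by rewrite -splitr.
apply: lerD => //; rewrite ler_pdivrMr ?ltr0n // -ler_pdivrMl // mulrC.
apply: le_trans (ltW (truncnS_gt _)) _; rewrite ler_nat; exact: Mm.
Qed.

(** For each cell of the grid, consider the event that [E] holds, that exactly
    [n] events have happened before the cell, and that the cell contains arrivals
    but no token. These events are disjoint and imply that event n + 1 is an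
    arrival. Because increments are independent of the past, the probability of
    each is that of its first two clauses times a constant; replacing the last
    clause by the presence of any event changes the constant, and the union is
    then [E] intersected with [separated n h]. The ratio of the two constants is
    at least alpha (1 - mu h). The same works with arrivals and tokens exchanged. *)
Lemma next_event_lower n h E : event_history n E -> 0 < h -> measurable (separated n h) ->
  ((lam / mu * (1 - mu * h))%:E * P (E `&` separated n h) <=
     P (E `&` [set o | event_is_arrival (path_of o) n.+1]))%E /\
  (((1 - p) / mu * (1 - mu * h))%:E * P (E `&` separated n h) <=
     P (E `&` ~` [set o | event_is_arrival (path_of o) n.+1]))%E.
Proof.
move=> HE h0 msep; have mE := event_history_measurable V HE.
set xi := [set o | event_is_arrival (path_of o) n.+1].
have mxi : measurable xi.
  by apply: (event_history_measurable V (n := n.+1)); exact: (event_history_is_arrival V).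
have t0 (c : nat) : 0 <= c%:R * h by rewrite mulr_ge0 // ltW.
have tS (c : nat) : c%:R * h < c.+1%:R * h by rewrite ltr_pM2r // ltr_nat.
have hE (c : nat) : c.+1%:R * h - c%:R * h = h by rewrite -natr1; ring.
pose Ec c := E `&` [set o | events (path_of o) (c%:R * h) = n].
have FEc c : Ft (c%:R * h) (Ec c).
  rewrite (_ : Ec c = (E `&` [set o | (event_time (path_of o) n <= (c%:R * h)%:E)%E]) `&`
      [set o | events (path_of o) (c%:R * h) = n]).
    apply: (salgI (gen_salg _)); first exact: (proj2 HE).
    by apply: (@filtration_events _ _ _ _ [set k | k = n]); rewrite t0 lexx.
  apply/seteqP; split=> o; last by case=> -[].
  case=> Eo No; split=> //; split => //=.
  by rewrite event_time_le // ?No //; exact: sample_path_regular V o.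
have mEc c : measurable (Ec c) := filtration_measurable V (FEc c).
pose I c B C := incr A (c%:R * h) (c.+1%:R * h) B `&` incr S (c%:R * h) (c.+1%:R * h) C.
have mI c B C : measurable (I c B C) by apply: measurableI; [exact: mincrA|exact: mincrS].
have PI c B C : P (Ec c `&` I c B C) = (P (I c B C) * P (Ec c))%E.
  by apply: filtration_indep => //; exact: ltW.
pose pos := [set k | (0 < k)%N].
have mono o := events_path (sample_path_regular V o).
have jump c o : (Ec c `&` ~` I c [set 0%N] [set 0%N]) o ->
    events (path_of o) (c%:R * h) = n /\ (n < events (path_of o) (c.+1%:R * h))%N.
  rewrite /I /incr => -[[Eo /= No] nI]; split => //.
  have Am := poisson_nondecreasing HA o (t0 c) (ltW (tS c)).
  have Sm := poisson_nondecreasing HS o (t0 c) (ltW (tS c)).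
  move: No nI; rewrite /events /=; move: Am Sm.
  move: (A (c.+1%:R * h) o) (A (c%:R * h) o) (S (c.+1%:R * h) o) (S (c%:R * h) o).
  move=> a' a b' b; clear => h1 h2 <- h4.
  by rewrite ltnNge; apply/negP => h5; apply: h4; split; lia.
have jumpC c o : Ec c o -> (n < events (path_of o) (c.+1%:R * h))%N ->
    (~` I c [set 0%N] [set 0%N]) o.
  move=> [_ /= No] Nn; rewrite /I /incr /= => -[h1 h2].
  have Am := poisson_nondecreasing HA o (t0 c) (ltW (tS c)).
  have Sm := poisson_nondecreasing HS o (t0 c) (ltW (tS c)).
  move: No Nn h1 h2; rewrite /events /=; move: Am Sm.
  move: (A (c.+1%:R * h) o) (A (c%:R * h) o) (S (c.+1%:R * h) o) (S (c%:R * h) o).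
  by move=> a' a b' b; clear; lia.
have unique c c' o : events (path_of o) (c%:R * h) = n -> (n < events (path_of o) (c.+1%:R * h))%N ->
    events (path_of o) (c'%:R * h) = n -> (n < events (path_of o) (c'.+1%:R * h))%N -> c = c'.
  have mon := mono o; case: mon => _ mon _.
  wlog cc' : c c' / (c <= c')%N.
    move=> W e1 e2 e3 e4; case: (leqP c c') => [/W|/ltnW/W]; first exact.
    by move=> ->.
  move=> e1 e2 e3 e4; apply/eqP; rewrite eqn_leq cc' /= leqNgt; apply/negP => lt.
  have : (events (path_of o) (c.+1%:R * h) <= events (path_of o) (c'%:R * h))%N.
    by apply: mon => //; rewrite ler_pM2r // ler_nat.
  by rewrite e3 leqNgt e2.
have sepE : E `&` separated n h = \bigcup_c (Ec c `&` ~` I c [set 0%N] [set 0%N]).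
  apply/seteqP; split=> o.
    by move=> [Eo [c [h1 h2]]]; exists c => //; split; [split|exact: jumpC].
  by move=> [c _ h1]; split; [by case: h1 => -[]|exists c; exact: jump].
have tr (F : nat -> set (model_space X)) :
    (forall c, F c `<=` Ec c `&` ~` I c [set 0%N] [set 0%N]) -> trivIset setT F.
  move=> FE; apply/trivIsetP => c c' _ _ cc'; apply/seteqP; split=> // o [/FE/jump[h1 h2] /FE/jump[h3 h4]].
  by move/eqP: cc'; apply; exact: (unique c c' o).
pose Sg := (\sum_(c <oo) P (Ec c))%E.
have Sg0 : (0 <= Sg)%E by exact: nneseries_ge0.
pose e := 1 - expR (- (mu * h)).
have muh0 : 0 < mu * h by rewrite mulr_gt0.
have e0 : 0 < e by rewrite subr_gt0 expR_lt1 oppr_lt0.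
have Psep : P (E `&` separated n h) = (e%:E * Sg)%E.
  rewrite sepE probability_bigcup; last 2 first.
  - by move=> c; apply: measurableI => //; exact: measurableC.
  - by apply: (tr (fun c => Ec c `&` ~` I c [set 0%N] [set 0%N])) => c; exact: subset_refl.
  rewrite -nneseriesZl //; apply: eq_eseriesr => c _.
  have -> : P (Ec c `&` ~` I c [set 0%N] [set 0%N]) = (P (Ec c) - P (Ec c `&` I c [set 0%N] [set 0%N]))%E.
    by rewrite -setDE measureD // ltey_eq fin_num_measure.
  rewrite PI incr_indep // (incr_eq0 l0 HA) // (incr_eq0 q0 HS) // hE.
  rewrite -EFinM -expRD -[in LHS](fineK (fin_num_measure P _ (mEc c))) -EFinM -EFinB.
  rewrite -[in RHS](fineK (fin_num_measure P _ (mEc c))) -EFinM; congr EFin.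
  rewrite (_ : - (lam * h) + - ((1 - p) * h) = - (mu * h)) /e; last by rewrite /mu; ring.
  by ring.
have lower (G : set (model_space X)) B C (v r0 : R) : measurable G ->
    (forall c, P (I c B C) = v%:E) -> r0 * e <= v ->
    (forall c, Ec c `&` I c B C `<=` G) -> (forall c, I c B C `<=` ~` I c [set 0%N] [set 0%N]) ->
    (r0%:E * P (E `&` separated n h) <= P G)%E.
  move=> mG Pv rv sub sub0.
  apply: le_trans (_ : (P (\bigcup_c (Ec c `&` I c B C)) <= _)%E); last first.
    apply: le_measure; rewrite ?inE //; last exact: bigcup_sub.
    by apply: bigcupT_measurable => c; exact: measurableI.
  rewrite probability_bigcup; last 2 first.
  - by move=> c; exact: measurableI.
  - by apply: tr => c; exact: setIS.
  rewrite (eq_eseriesr (g := fun c => (v%:E * P (Ec c))%E)); last by move=> c _; rewrite PI Pv.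
  rewrite nneseriesZl // -/Sg Psep muleA -EFinM.
  by apply: lee_wpmul2r => //; rewrite lee_fin.
have ele : e <= mu * h by have := expR_ge1Dx (- (mu * h)); rewrite /e; lra.
have rate_le x : 0 < x -> x * h * expR (- (x * h)) <= 1 - expR (- (x * h)).
  move=> x0; have := expR_ge1Dx (x * h) => hx.
  have := expR_gt0 (- (x * h)) => Ex.
  have : (1 + x * h) * expR (- (x * h)) <= expR (x * h) * expR (- (x * h)).
    by rewrite ler_pM2r.
  by rewrite -expRD subrr expR0; lra.
have bound x y : 0 < x -> x + y = mu ->
    x / mu * (1 - mu * h) * e <= (1 - expR (- (x * h))) * expR (- (y * h)).
  move=> x0 xy; have := expR_ge1Dx (- (mu * h)) => hx.
  apply: le_trans (_ : x * h * expR (- (mu * h)) <= _); last first.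
    rewrite (_ : - (mu * h) = - (x * h) + - (y * h)); last by rewrite -xy; ring.
    by rewrite expRD mulrA ler_pM2r ?expR_gt0 //; exact: rate_le.
  have [neg|pos1] := leP (1 - mu * h) 0.
    apply: le_trans (_ : 0 <= _); last by rewrite !mulr_ge0 ?expR_ge0 // ltW.
    by rewrite mulr_le0_ge0 ?(ltW e0) // mulr_ge0_le0 // ltW // divr_gt0.
  apply: le_trans (_ : x / mu * (1 - mu * h) * (mu * h) <= _).
    by apply: ler_wpM2l => //; rewrite mulr_ge0 ?ltW // divr_gt0.
  rewrite (_ : _ * (mu * h) = x * h * (1 - mu * h)); last by field; rewrite gt_eqF.
  by apply: ler_wpM2l; [rewrite mulr_ge0 // ltW|].
have subA c : I c pos [set 0%N] `<=` ~` I c [set 0%N] [set 0%N].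
  by move=> o [/= h1 h2] [h3 _]; move: h1 h3; rewrite /incr /pos /= => /[swap] ->.
have subS c : I c [set 0%N] pos `<=` ~` I c [set 0%N] [set 0%N].
  by move=> o [/= h1 h2] [_ h3]; move: h2 h3; rewrite /incr /pos /= => /[swap] ->.
have tt c : 0 <= c%:R * h <= c.+1%:R * h by rewrite t0 ltW.
split.
- apply: (lower _ pos [set 0%N] ((1 - expR (- (lam * h))) * expR (- ((1 - p) * h)))) => //.
  + exact: measurableI.
  + by move=> c; rewrite incr_indep // (incr_ge1 l0 HA) // (incr_eq0 q0 HS) // hE.
  + by apply: bound => //; rewrite /mu; ring.
  move=> c o [Eco Ico]; split; first by case: Eco.
  have [No Nn] := jump c o (conj Eco (subA c o Ico)).
  apply: (proj1 (next_event (sample_path_regular V o) (tt c) No Nn)) => /=.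
  case: Ico => _; rewrite /incr /= => /eqP; rewrite subn_eq0 => h1.
  by apply/eqP; rewrite eqn_leq h1 (poisson_nondecreasing HS) // ltW.
- apply: (lower _ [set 0%N] pos ((1 - expR (- ((1 - p) * h))) * expR (- (lam * h)))) => //.
  + by apply: measurableI => //; exact: measurableC.
  + move=> c; rewrite incr_indep // (incr_ge1 q0 HS) // (incr_eq0 l0 HA) // hE.
    by rewrite -EFinM mulrC.
  + by apply: bound => //; rewrite /mu; ring.
  move=> c o [Eco Ico]; split; first by case: Eco.
  have [No Nn] := jump c o (conj Eco (subS c o Ico)).
  apply/negP; apply: (proj2 (next_event (sample_path_regular V o) (tt c) No Nn)) => /=.
  case: Ico => + _; rewrite /incr /= => /eqP; rewrite subn_eq0 => h1.
  by apply/eqP; rewrite eqn_leq h1 (poisson_nondecreasing HA) // ltW.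
Qed.

(** As the mesh tends to 0, the lower bounds for an arrival and for a token tend
    to alpha P(E) and beta P(E). Since alpha + beta = 1, both are equalities. *)
Lemma next_event_arrival n E : event_history n E ->
  P (E `&` [set o | event_is_arrival (path_of o) n.+1]) = ((lam / mu)%:E * P E)%E.
Proof.
move=> HE; have mE := event_history_measurable V HE.
set xi := [set o | event_is_arrival (path_of o) n.+1].
have mxi : measurable xi.
  by apply: (event_history_measurable V (n := n.+1)); exact: (event_history_is_arrival V).
have fE F : measurable F -> P F = (fine (P F))%:E.
  by move=> mF; rewrite fineK // fin_num_measure.
have mI : measurable (E `&` xi) by exact: measurableI.
have mC : measurable (E `&` ~` xi) by apply: measurableI => //; exact: measurableC.
have split_xi : fine (P E) = fine (P (E `&` xi)) + fine (P (E `&` ~` xi)).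
  rewrite -fineD ?fin_num_measure // -measureU //; last first.
    by rewrite setIACA setICr setI0.
  by rewrite -setIUr setUCr setIT.
have lim (x : R) (G : set (model_space X)) : 0 < x -> x <= mu -> measurable G ->
    (forall h, 0 < h -> measurable (separated n h) ->
      ((x / mu * (1 - mu * h))%:E * P (E `&` separated n h) <= P (E `&` G))%E) ->
    x / mu * fine (P E) <= fine (P (E `&` G)).
  move=> x0 xmu mG H; apply/ler_addgt0Pr => eps eps0.
  have e2 : 0 < eps / 2 by rewrite divr_gt0.
  have [M HM] := separated_likely n e2.
  pose m := (maxn M (Num.truncn (mu / (eps / 2)))).+1.
  have m0 : 0 < m%:R :> R by rewrite ltr0n.
  have [|msep Psep] := HM m; first by rewrite ltnS leq_maxl.
  have muh : mu * m%:R^-1 <= eps / 2.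
    rewrite ler_pdivrMr // -ler_pdivrMl // mulrC ltW //.
    by apply: lt_le_trans (truncnS_gt _) _; rewrite ler_nat ltnS leq_maxr.
  have := H m%:R^-1 ltac:(by rewrite invr_gt0) msep.
  have mEs : measurable (E `&` separated n m%:R^-1) by exact: measurableI.
  have mEG : measurable (E `&` G) by exact: measurableI.
  move=> H1; rewrite (fE _ mEs) (fE _ mEG) -EFinM lee_fin in H1.
  have PE1 : fine (P E) <= 1 by rewrite -lee_fin -fE //; exact: probability_le1.
  have PE : fine (P E) - eps / 2 <= fine (P (E `&` separated n m%:R^-1)).
    rewrite lerBlDr -lee_fin EFinD -!fE //.
    apply: le_trans (_ : (P (E `&` separated n m%:R^-1) + P (~` separated n m%:R^-1) <= _)%E).
      apply: le_trans (measureU2 _ _ _) => //; last exact: measurableC.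
      apply: le_measure; rewrite ?inE //; first by apply: measurableU => //; exact: measurableC.
      by move=> o Eo; have [s|s] := pselect (separated n m%:R^-1 o); [left|right].
    by apply: leeD.
  have Ps1 : fine (P (E `&` separated n m%:R^-1)) <= 1.
    by rewrite -lee_fin -fE //; exact: probability_le1.
  have Ps0 : 0 <= fine (P (E `&` separated n m%:R^-1)) by rewrite fine_ge0.
  set u := fine (P (E `&` separated _ _)) in H1 PE Ps1 Ps0.
  set y := fine (P E) in PE1 PE *; set g := fine (P (E `&` G)) in H1 *.
  set k := mu * m%:R^-1 in H1 muh.
  have k0 : 0 <= k by rewrite /k mulr_ge0 ?invr_ge0 // ltW.
  have xm1 : x / mu <= 1 by rewrite ler_pdivrMr // mul1r.
  have xm0 : 0 <= x / mu by rewrite divr_ge0 // ltW.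
  have ku : k * u <= eps / 2.
    by apply: le_trans (ler_pM _ _ muh Ps1) _ => //; rewrite mulr1.
  have step : x / mu * (y - u + k * u) <= eps.
    apply: le_trans (_ : x / mu * eps <= _); last by rewrite ler_piMl // ltW.
    by apply: ler_wpM2l => //; lra.
  move: H1; rewrite (_ : x / mu * (1 - k) * u = x / mu * y - x / mu * (y - u + k * u)); last by ring.
  by lra.
have hA := lim lam xi l0 ltac:(by rewrite /mu -addrA lerDl ltW) mxi
  (fun h pos ms => proj1 (next_event_lower HE pos ms)).
have hS := lim (1 - p) (~` xi) q0 ltac:(by rewrite /mu -addrA lerDr ltW) (measurableC mxi)
  (fun h pos ms => proj2 (next_event_lower HE pos ms)).
rewrite (fE _ mI) (fE _ mE) -EFinM; congr EFin.
have : (1 - p) / mu = 1 - lam / mu by rewrite /mu; field; rewrite gt_eqF.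
move=> e1; move: hA hS split_xi; rewrite e1 mulrBl mul1r.
by set z := lam / mu * fine (P E); lra.
Qed.

End NextEventType.

(** * Bounded random variables and limits superior *)

Section BoundedExpectation.
Context (R : realType) (d : measure_display) (T : measurableType d).
Variable P : probability T R.
Implicit Types (f g : T -> R) (E : set T).

Definition bounded_rv f : Prop :=
  measurable_fun setT f /\ exists C, forall w, `|f w| <= C.

Definition Ex f : R := \int[P]_w f w.

Lemma bounded_rv_integrable f : bounded_rv f -> P.-integrable setT (EFin \o f).
Proof.
move=> [mf [C fC]]; apply: measurable_bounded_integrable => //.
  by rewrite (le_lt_trans (probability_le1 P measurableT)) // ltry.
exists C; split; first exact: num_real.
by move=> x Cx w _ /=; exact: le_trans (fC w) (ltW Cx).
Qed.

Lemma bounded_rv_cst c : bounded_rv (fun=> c).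
Proof. by split; [exact: measurable_cst|exists `|c|]. Qed.

Lemma bounded_rvD f g : bounded_rv f -> bounded_rv g -> bounded_rv (fun w => f w + g w).
Proof.
move=> [mf [C fC]] [mg [D gD]]; split; first exact: measurable_funD.
by exists (C + D) => w; apply: le_trans (ler_normD _ _) (lerD (fC w) (gD w)).
Qed.

Lemma bounded_rvM f g : bounded_rv f -> bounded_rv g -> bounded_rv (fun w => f w * g w).
Proof.
move=> [mf [C fC]] [mg [D gD]]; split; first exact: measurable_funM.
by exists (C * D) => w; rewrite normrM ler_pM.
Qed.

Lemma bounded_rvZ c f : bounded_rv f -> bounded_rv (fun w => c * f w).
Proof. by move=> bf; apply: bounded_rvM bf; exact: bounded_rv_cst. Qed.

Lemma bounded_rv_sum (I : Type) (s : seq I) (F : I -> T -> R) :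
  (forall i, bounded_rv (F i)) -> bounded_rv (fun w => \sum_(i <- s) F i w).
Proof.
move=> bF; elim: s => [|i s IH].
  rewrite (_ : (fun _ => _) = fun=> 0); first exact: bounded_rv_cst.
  by apply/funext => w; rewrite big_nil.
rewrite (_ : (fun _ => _) = fun w => F i w + \sum_(j <- s) F j w); first exact: bounded_rvD.
by apply/funext => w; rewrite big_cons.
Qed.

Lemma bounded_rv_indic (b : T -> bool) :
  measurable [set w | b w] -> bounded_rv (fun w => (b w)%:R).
Proof.
move=> mb; split; last by exists 1 => w; case: (b w); rewrite ?normr1 ?normr0.
rewrite (_ : (fun _ => _) = \1_[set w | b w]); first exact: measurable_indic.
by apply/funext => w; rewrite indicE mem_setE.
Qed.

Lemma Ex_cst c : Ex (fun=> c) = c.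
Proof.
transitivity (c * fine (P setT)); first exact: Rintegral_cst.
by rewrite probability_setT mulr1.
Qed.

Lemma ExD f g : bounded_rv f -> bounded_rv g -> Ex (fun w => f w + g w) = Ex f + Ex g.
Proof. by move=> bf bg; rewrite /Ex RintegralD //; exact: bounded_rv_integrable. Qed.

Lemma ExZ c f : bounded_rv f -> Ex (fun w => c * f w) = c * Ex f.
Proof. by move=> bf; rewrite /Ex RintegralZl //; exact: bounded_rv_integrable. Qed.

Lemma Ex_le f g : bounded_rv f -> bounded_rv g -> (forall w, f w <= g w) -> Ex f <= Ex g.
Proof. by move=> bf bg fg; apply: le_Rintegral => //; exact: bounded_rv_integrable. Qed.

Lemma Ex_sum (I : Type) (s : seq I) (F : I -> T -> R) : (forall i, bounded_rv (F i)) ->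
  Ex (fun w => \sum_(i <- s) F i w) = \sum_(i <- s) Ex (F i).
Proof.
move=> bF; elim: s => [|i s IH].
  rewrite big_nil (_ : (fun _ => _) = fun=> 0) ?Ex_cst //.
  by apply/funext => w; rewrite big_nil.
rewrite big_cons -IH -ExD //; last exact: bounded_rv_sum.
by congr Ex; apply/funext => w; rewrite big_cons.
Qed.

Lemma Ex_indic (b : T -> bool) : measurable [set w | b w] ->
  Ex (fun w => (b w)%:R) = fine (P [set w | b w]).
Proof.
move=> mb; rewrite /Ex /Rintegral; congr fine.
transitivity (P ([set w | b w] `&` setT)); last by rewrite setIT.
rewrite -integral_indic //.
by apply: eq_integral => w _; rewrite indicE mem_setE.
Qed.

Lemma Ex_integral f : bounded_rv f -> (Ex f)%:E = (\int[P]_w (f w)%:E)%E.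
Proof.
move=> bf; rewrite /Ex /Rintegral fineK //.
by apply: integrable_fin_num => //; exact: bounded_rv_integrable.
Qed.

End BoundedExpectation.

Section LimitSuperior.
Context (R : realType).
Implicit Types u v : nat -> \bar R.

Lemma limn_esup_le u l N : (forall n, (N <= n)%N -> (u n <= l)%E) -> (limn_esup u <= l)%E.
Proof.
move=> ul; apply: (@le_trans _ _ (ereal_sup (u @` [set n | (N <= n)%N]))).
  by apply: ereal_inf_lbound; exists [set n | (N <= n)%N] => //; exists N.
by apply: ge_ereal_sup => _ [n /= Nn <-]; exact: ul.
Qed.

Lemma limn_esup_lt u l : (limn_esup u < l)%E ->
  exists N, forall n, (N <= n)%N -> (u n < l)%E.
Proof.
move=> /ereal_inf_lt[_ [A [N _ NA] <-] Al]; exists N => n Nn.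
by apply: le_lt_trans Al; apply: ereal_sup_ubound; exists n => //; exact: NA.
Qed.

End LimitSuperior.

(** * The controlled chain *)

(** All that the estimates retain of the model and of a policy: the types [xi]
    of the events, the deletions [D], and the information [G n] available at
    event [n], of which the type of event [n.+1] is independent. *)
Record decision_process (R : realType) (d : measure_display) (T : measurableType d)
    (P : probability T R) (alpha : R) (xi D : nat -> T -> bool) (G : nat -> set (set T)) : Prop := {
  dp_salg : forall n, sigma_algebra setT (G n);
  dp_meas : forall n, G n `<=` measurable;
  dp_mono : forall n, G n `<=` G n.+1;
  dp_arrival : forall n, G n.+1 [set w | xi n.+1 w];
  dp_deleted : forall n, G n.+1 [set w | D n.+1 w];
  dp_next : forall n E, G n E -> P (E `&` [set w | xi n.+1 w]) = (alpha%:E * P E)%E }.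

Section DecisionProcess.
Context (R : realType) (d : measure_display) (T : measurableType d).
Variables (P : probability T R) (alpha : R) (xi D : nat -> T -> bool) (G : nat -> set (set T)).
Hypothesis DP : decision_process P alpha xi D G.
Implicit Types (n : nat) (w : T).

Definition queue_at n w : nat := controlled_queue (xi^~ w) (D^~ w) n.
Definition deleted_by n w : nat := \sum_(1 <= k < n.+1) D k w.

Lemma deleted_byS n w : deleted_by n.+1 w = (deleted_by n w + D n.+1 w)%N.
Proof. by rewrite /deleted_by big_nat_recr. Qed.

Lemma queue_at_le n w : (queue_at n w <= n)%N.
Proof.
elim: n => [//|n IH]; rewrite /queue_at /= -/(queue_at n w).
by case: ifP => _; [case: ifP => _|]; lia.
Qed.

Lemma deleted_by_le n w : (deleted_by n w <= n)%N.
Proof.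
elim: n => [|n IH]; first by rewrite /deleted_by big_geq.
by rewrite deleted_byS; case: (D _ _); lia.
Qed.

Lemma state_history n (B : nat -> nat -> Prop) :
  G n [set w | B (queue_at n w) (deleted_by n w)].
Proof.
suff H c : G n [set w | (queue_at n w, deleted_by n w) = c].
  exact: (@salg_fibres _ _ (dp_salg DP n) _ (fun w => (queue_at n w, deleted_by n w))
    (fun c => B c.1 c.2) H).
elim: n c => [|n IH] c.
  rewrite (_ : [set _ | _] = if (0%N, 0%N) == c then setT else set0).
    by case: ifP => _; [exact: salgT (dp_salg DP 0)|exact: salg0 (dp_salg DP 0)].
  by apply/seteqP; split=> w /=; rewrite /deleted_by big_geq //; case: eqP.
have sG := dp_salg DP n.+1.
pose Z w := ((queue_at n w, deleted_by n w), xi n.+1 w, D n.+1 w).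
pose next z : nat * nat := let: ((q, k), x, y) := z in
  (if x then (if y then q else q.+1) else q.-1, (k + nat_of_bool y)%N).
rewrite (_ : [set _ | _] = [set w | next (Z w) = c]); last first.
  by apply/seteqP; split=> w /=; rewrite deleted_byS.
apply: (@salg_fibres _ _ sG _ Z (fun z => next z = c)) => -[[s x] y].
rewrite (_ : [set _ | _] = [set w | (queue_at n w, deleted_by n w) = s] `&`
    [set w | xi n.+1 w = x] `&` [set w | D n.+1 w = y]); last first.
  by apply/seteqP; split=> w; [case=> h1 h2 h3; split; [split|]|case=> -[/= <- <-] <-].
apply: (salgI sG); first apply: (salgI sG).
- by apply: (dp_mono DP); exact: IH.
- exact: (@salg_bool _ _ sG (xi n.+1) (fun b => b = x) (dp_arrival DP n)).
- exact: (@salg_bool _ _ sG (D n.+1) (fun b => b = y) (dp_deleted DP n)).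
Qed.

Let mstate n (B : nat -> nat -> Prop) : measurable [set w | B (queue_at n w) (deleted_by n w)].
Proof. exact/(dp_meas DP)/state_history. Qed.

Lemma marrival n : measurable [set w | xi n.+1 w].
Proof. by apply: (dp_meas DP); exact: (dp_arrival DP). Qed.

(** Both coordinates of the state at time [n] are at most [n], so expectations of
    functions of the state are finite combinations of probabilities in [G n]. *)
Lemma state_decomposition n (F : nat -> nat -> R) w :
  F (queue_at n w) (deleted_by n w) =
  \sum_(c : 'I_n.+1 * 'I_n.+1)
     F c.1 c.2 * ((queue_at n w == c.1) && (deleted_by n w == c.2))%:R.
Proof.
pose c0 : 'I_n.+1 * 'I_n.+1 := (inord (queue_at n w), inord (deleted_by n w)).
have q0 : queue_at n w = c0.1 by rewrite /= inordK // ltnS queue_at_le.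
have k0 : deleted_by n w = c0.2 by rewrite /= inordK // ltnS deleted_by_le.
rewrite (bigD1 c0) //= big1 ?addr0.
  by rewrite -q0 -k0 !eqxx mulr1.
move=> -[i j] /eqP ne; rewrite [X in _ * X](_ : _ = 0) ?mulr0 //.
case: andP => // -[/= /eqP h1 /eqP h2]; case: ne; congr pair; apply: val_inj => /=.
  by rewrite -h1.
by rewrite -h2.
Qed.

Lemma state_rv n (F : nat -> nat -> R) :
  bounded_rv (fun w => F (queue_at n w) (deleted_by n w)).
Proof.
rewrite (funext (state_decomposition n F)).
apply: bounded_rv_sum => c; apply: bounded_rvZ; apply: bounded_rv_indic.
exact: (mstate n (fun q k => (q == c.1) && (k == c.2))).
Qed.

Lemma arrival_rv n : bounded_rv (fun w => (xi n.+1 w)%:R : R).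
Proof. exact/bounded_rv_indic/marrival. Qed.

Lemma Ex_arrival n (F : nat -> nat -> R) :
  Ex P (fun w => (xi n.+1 w)%:R * F (queue_at n w) (deleted_by n w)) =
  alpha * Ex P (fun w => F (queue_at n w) (deleted_by n w)).
Proof.
pose b (c : 'I_n.+1 * 'I_n.+1) w := (queue_at n w == c.1) && (deleted_by n w == c.2).
have Gb c : G n [set w | b c w] := state_history n (fun q k => (q == c.1) && (k == c.2)).
have mb c : measurable [set w | b c w] := dp_meas DP (Gb c).
have rb c : bounded_rv (fun w => (b c w)%:R : R) := bounded_rv_indic R (mb c).
have -> : (fun w => F (queue_at n w) (deleted_by n w)) =
    fun w => \sum_(c : 'I_n.+1 * 'I_n.+1) F c.1 c.2 * (b c w)%:R.
  by apply/funext => w; exact: state_decomposition.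
have -> : (fun w => (xi n.+1 w)%:R * F (queue_at n w) (deleted_by n w)) =
    fun w => \sum_(c : 'I_n.+1 * 'I_n.+1) F c.1 c.2 * ((b c w && xi n.+1 w)%:R).
  apply/funext => w; rewrite state_decomposition mulr_sumr; apply: eq_bigr => c _.
  by rewrite mulrCA -natrM mulnb andbC.
have mbx c : measurable [set w | b c w && xi n.+1 w].
  rewrite (_ : [set _ | _] = [set w | b c w] `&` [set w | xi n.+1 w]).
    by apply: measurableI; [exact: mb|exact: marrival].
  by apply/seteqP; split=> w /=; [case/andP|case=> -> ->].
rewrite !Ex_sum; last 2 first.
- by move=> c; apply: bounded_rvZ; exact: rb.
- by move=> c; apply: bounded_rvZ; exact: bounded_rv_indic.
rewrite mulr_sumr; apply: eq_bigr => c _.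
rewrite !ExZ //; last exact: bounded_rv_indic.
rewrite mulrCA !Ex_indic //; congr (_ * _).
have -> : [set w | b c w && xi n.+1 w] = [set w | b c w] `&` [set w | xi n.+1 w].
  by apply/seteqP; split=> w /=; [case/andP|case=> -> ->].
by rewrite (dp_next DP) // fineM // fin_num_measure.
Qed.

(** The next type being independent of the state, the indicator of an arrival can
    be replaced by its probability. *)
Lemma Ex_step n (F1 F2 : nat -> nat -> R) :
  Ex P (fun w => if xi n.+1 w then F1 (queue_at n w) (deleted_by n w)
                 else F2 (queue_at n w) (deleted_by n w)) =
  Ex P (fun w => alpha * F1 (queue_at n w) (deleted_by n w) +
                 (1 - alpha) * F2 (queue_at n w) (deleted_by n w)).
Proof.
pose F q k := F1 q k - F2 q k.
have -> : (fun w => if xi n.+1 w then F1 (queue_at n w) (deleted_by n w)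
                    else F2 (queue_at n w) (deleted_by n w)) =
   fun w => (xi n.+1 w)%:R * F (queue_at n w) (deleted_by n w) + F2 (queue_at n w) (deleted_by n w).
  by apply/funext => w; rewrite /F; case: (xi _ _) => /=; ring.
have rF := state_rv n F; have rF2 := state_rv n F2.
rewrite ExD //; last by apply: bounded_rvM => //; exact: arrival_rv.
rewrite Ex_arrival -ExZ // -ExD //; last exact: bounded_rvZ.
by congr Ex; apply/funext => w; rewrite /F; ring.
Qed.

End DecisionProcess.

(** * Deletion frequency of a threshold policy *)

Lemma expR_le_quadratic (R : realType) (x : R) : x <= 1 / 2 -> expR x <= 1 + x + 2 * x ^+ 2.
Proof.
move=> x2; have h := expR_ge1Dx (- x); have Ex := expR_gt0 x.
have : expR x * (1 - x) <= 1.
  apply: le_trans (_ : expR x * expR (- x) <= _); first by rewrite ler_pM2l.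
  by rewrite -expRD subrr expR0.
have pos : 0 < 1 - x by lra.
rewrite -ler_pdivlMr // => /le_trans; apply.
rewrite ler_pdivrMr // -subr_ge0.
rewrite (_ : _ - _ = x ^+ 2 * (1 - 2 * x)); last by ring.
by rewrite mulr_ge0 ?sqr_ge0 //; lra.
Qed.

Lemma nneseries_geometric_lty (R : realType) (u : nat -> \bar R) (C x : R) :
  0 <= C -> 0 < x < 1 -> (forall n, (0 <= u n)%E) -> (forall n, (u n <= (C * x ^+ n)%:E)%E) ->
  (\sum_(n <oo) u n < +oo)%E.
Proof.
move=> C0 /andP[x0 x1] u0 uC.
apply: (@le_lt_trans _ _ (C * (1 - x)^-1)%:E); last exact: ltry.
apply: lime_le; first exact: is_cvg_nneseries.
apply: nearW => n; apply: le_trans (lee_sum _ (fun i _ => uC i)) _.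
rewrite sumEFin lee_fin.
have := @geometric_le_lim R n C x C0 x0; rewrite (ger0_norm (ltW x0)) => /(_ x1).
by rewrite /series /=.
Qed.

Section ThresholdFrequency.
Context (R : realType) (d : measure_display) (T : measurableType d).
Variables (P : probability T R) (alpha : R) (xi D : nat -> T -> bool) (G : nat -> set (set T)).
Hypothesis DP : decision_process P alpha xi D G.
Variables (L : nat) (r : R) (h : nat -> R).
Hypotheses (alpha01 : 0 < alpha < 1) (DL : forall n w, D n.+1 w = xi n.+1 w && (L <= queue_at xi D n w)%N).
(* The number of deletions plus the potential [h] grows by at most [r] per step,
   on average. *)
Hypotheses (h0 : forall q, 0 <= h q)
  (drift_below : forall q, (q < L)%N -> alpha * (h q.+1 - h q) + (1 - alpha) * (h q.-1 - h q) <= r)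
  (drift_at : alpha + (1 - alpha) * (h L.-1 - h L) <= r).

Local Notation Q := (queue_at xi D).
Local Notation K := (deleted_by D).

Lemma threshold_state_le n w : (Q n w <= L)%N.
Proof.
elim: n => [//|n IH]; rewrite /queue_at /= -/(Q n w) DL.
case: (xi _ _) => /=; last exact: leq_trans (leq_pred _) IH.
by case: (leqP L (Q n w)) => // _.
Qed.

(* At level [L] an arrival is deleted: the count grows by 1 and the level stays. *)
Let jump q := if (q < L)%N then h q.+1 - h q else 1.
Let drop q := h q.-1 - h q.
Let Bd := 1 + \sum_(q < L.+1) (`|jump q| + `|drop q|).

Let Bd_ge q : (q <= L)%N -> `|jump q| <= Bd /\ `|drop q| <= Bd.
Proof.
move=> qL; suff : `|jump q| + `|drop q| <= Bd.
  by move=> le; split; apply: le_trans le; rewrite ?lerDl ?lerDr.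
rewrite /Bd (bigD1 (Ordinal (qL : (q < L.+1)%N))) //= addrCA lerDl addr_ge0 //.
by apply: sumr_ge0 => i _; exact: addr_ge0.
Qed.

Let Bd1 : 1 <= Bd.
Proof. by rewrite lerDl; apply: sumr_ge0 => i _; exact: addr_ge0. Qed.

(** The first-order term of the exponentials is the drift; the chain lives on
    finitely many levels, so the second-order term is uniformly small. *)
Lemma threshold_mgf_step theta q : (q <= L)%N -> 0 < theta -> theta * Bd <= 1 / 2 ->
  alpha * expR (theta * jump q) + (1 - alpha) * expR (theta * drop q)
  <= expR (theta * r + 2 * theta ^+ 2 * Bd ^+ 2).
Proof.
move=> qL th0 thB; have [a0 a1] := andP alpha01.
have [jB dB] := Bd_ge qL; have a1' : 0 <= 1 - alpha by lra.
have small x : `|x| <= Bd -> expR (theta * x) <= 1 + theta * x + 2 * theta ^+ 2 * Bd ^+ 2.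
  move=> xB; apply: le_trans (expR_le_quadratic _) _.
    apply: le_trans thB; rewrite ler_pM2l //; exact: le_trans (ler_norm _) xB.
  rewrite lerD2l exprMn mulrA; apply: ler_wpM2l; first by rewrite mulr_ge0 // sqr_ge0.
  by rewrite -(real_normK (num_real x)) lerXn2r // nnegrE (le_trans _ xB).
apply: le_trans (lerD (ler_wpM2l (ltW a0) (small _ jB)) (ler_wpM2l a1' (small _ dB))) _.
apply: le_trans (expR_ge1Dx _).
set c := 2 * _ * _; set u := jump q; set v := drop q.
rewrite [leLHS](_ : _ = 1 + theta * (alpha * u + (1 - alpha) * v) + c); last by ring.
rewrite -addrA lerD2l lerD2r ler_pM2l // /u /v /jump /drop.
case: ifP => [|/negbT]; first exact: drift_below.
by rewrite -leqNgt => Lq; rewrite mulr1 (_ : q = L) //; apply/eqP; rewrite eqn_leq qL.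
Qed.

Lemma threshold_mgf theta n : 0 < theta -> theta * Bd <= 1 / 2 ->
  Ex P (fun w => expR (theta * ((K n w)%:R + h (Q n w)))) <=
  expR (theta * h 0%N) * expR (theta * r + 2 * theta ^+ 2 * Bd ^+ 2) ^+ n.
Proof.
move=> th0 thB; elim: n => [|n IH].
  rewrite expr0 mulr1 (_ : (fun _ => _) = fun=> expR (theta * h 0%N)) ?Ex_cst //.
  by apply/funext => w; rewrite /deleted_by big_geq // add0r.
pose F q k := expR (theta * (k%:R + h q)).
rewrite (_ : (fun _ => _) = (fun w => if xi n.+1 w
    then F (Q n w) (K n w) * expR (theta * jump (Q n w))
    else F (Q n w) (K n w) * expR (theta * drop (Q n w)))); last first.
  apply/funext => w; rewrite deleted_byS DL {2}/queue_at /= -/(Q n w) DL /F -!expRD /jump /drop.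
  case: (xi _ _) => /=; last by congr expR; rewrite addn0; ring.
  by case: ltnP => _ /=; congr expR; rewrite ?addn0 ?natrD; ring.
rewrite (Ex_step DP n (fun q k => F q k * expR (theta * jump q)) (fun q k => F q k * expR (theta * drop q))).
apply: le_trans (_ : Ex P (fun w => expR (theta * r + 2 * theta ^+ 2 * Bd ^+ 2) * F (Q n w) (K n w)) <= _).
  apply: Ex_le.
  - exact: (state_rv DP n (fun q k => alpha * (F q k * expR (theta * jump q)) +
      (1 - alpha) * (F q k * expR (theta * drop q)))).
  - exact: (state_rv DP n (fun q k => expR (theta * r + 2 * theta ^+ 2 * Bd ^+ 2) * F q k)).
  move=> w; rewrite (_ : _ + _ = (alpha * expR (theta * jump (Q n w)) +
      (1 - alpha) * expR (theta * drop (Q n w))) * F (Q n w) (K n w)); last by ring.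
  rewrite ler_pM2r ?expR_gt0 //; apply: threshold_mgf_step => //; exact: threshold_state_le.
rewrite ExZ; last exact: (state_rv DP n F).
by rewrite [_ ^+ n.+1]exprS [leRHS]mulrCA ler_pM2l ?expR_gt0.
Qed.

(** Chernoff's bound for deletions plus [h], which dominates the deletions. With
    theta small the quadratic term is at most half of the gain theta * eps, so
    the probabilities are summable and the Borel-Cantelli lemma applies. *)
Lemma threshold_deviation eps : 0 < eps ->
  {ae P, forall w, exists N, forall n, (N <= n)%N -> (K n w)%:R < (r + eps) * n%:R}.
Proof.
move=> eps0.
pose theta := Num.min (1 / (2 * Bd)) (eps / (4 * Bd ^+ 2)).
have Bd0 : 0 < Bd := lt_le_trans ltr01 Bd1.
have th0 : 0 < theta by rewrite lt_min !divr_gt0 // ?mulr_gt0 // exprn_gt0.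
have thB : theta * Bd <= 1 / 2.
  rewrite -ler_pdivlMr //; apply: le_trans (_ : 1 / (2 * Bd) <= _); first by rewrite ge_min lexx.
  by rewrite invfM mulrA.
have thB2 : 2 * theta * Bd ^+ 2 <= eps / 2.
  rewrite -ler_pdivlMr ?exprn_gt0 // -ler_pdivlMl //.
  apply: le_trans (_ : eps / (4 * Bd ^+ 2) <= _); first by rewrite ge_min lexx orbT.
  rewrite le_eqVlt; apply/orP; left; apply/eqP; field.
  by rewrite gt_eqF // exprn_gt0.
pose F n := [set w | (r + eps) * n%:R <= (K n w)%:R].
have mF n : measurable (F n).
  by apply: (dp_meas DP (n := n)); exact: (state_history DP n (fun q k => (r + eps) * n%:R <= k%:R)).
pose x := expR (- (theta * eps / 2)).
have PF n : (P (F n) <= (expR (theta * h 0%N) * x ^+ n)%:E)%E.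
  pose b w := (r + eps) * n%:R <= (K n w)%:R.
  have mb : measurable [set w | b w] by exact: mF.
  rewrite -[P _]fineK ?fin_num_measure // lee_fin -[F n]/[set w | b w] -Ex_indic //.
  rewrite -(ler_pM2l (expR_gt0 (theta * ((r + eps) * n%:R)))) -ExZ; last exact: bounded_rv_indic.
  apply: le_trans (_ : Ex P (fun w => expR (theta * ((K n w)%:R + h (Q n w)))) <= _).
    apply: Ex_le; first by apply: bounded_rvZ; exact: bounded_rv_indic.
      exact: (state_rv DP n (fun q k => expR (theta * (k%:R + h q)))).
    move=> w; case: (boolP (b w)) => bw /=; last by rewrite mulr0 expR_ge0.
    by rewrite mulr1 ler_expR ler_pM2l //; apply: le_trans bw _; rewrite lerDl.
  apply: le_trans (threshold_mgf n th0 thB) _.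
  rewrite [leRHS]mulrCA ler_pM2l ?expR_gt0 // /x -!expRM_natr -expRD ler_expR.
  rewrite (_ : theta * ((r + eps) * n%:R) + - (theta * eps / 2) * n%:R =
    (theta * r + theta * eps / 2) * n%:R); last by field.
  apply: ler_wpM2r => //; rewrite lerD2l expr2 (_ : _ * _ = theta * (2 * theta * Bd ^+ 2)); last by ring.
  by rewrite -[leRHS]mulrA ler_pM2l.
have lim0 : P (lim_sup_set F) = 0.
  apply: lim_sup_set_cvg0 => //; apply: (nneseries_geometric_lty (C := expR (theta * h 0%N)) (x := x)) => //.
  by rewrite expR_gt0 expR_lt1 oppr_lt0 divr_gt0 // mulr_gt0.
exists (lim_sup_set F); split => //.
  by apply: bigcapT_measurable => n; exact: bigcup_measurable.
move=> w /= nw n _; apply: contrapT => nF; apply: nw; exists n => k nk.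
rewrite ltNge; apply/negP => Fk; apply: nF; by exists k.
Qed.

Lemma threshold_frequency :
  {ae P, forall w, (limn_esup (fun n => ((K n w)%:R / n%:R)%:E) <= r%:E)%E}.
Proof.
have : {ae P, forall w, forall m : nat, exists N, forall n, (N <= n)%N ->
    (K n w)%:R < (r + m.+1%:R^-1) * n%:R}.
  by apply/ae_foralln => m; apply: threshold_deviation; rewrite invr_gt0.
apply: filterS => w Hw; apply/lee_addgt0Pr => eps eps0.
pose m := Num.truncn (eps^-1).
have me : m.+1%:R^-1 <= eps.
  by rewrite invf_ple ?posrE // ltW // truncnS_gt.
have [N HN] := Hw m; apply: (@limn_esup_le _ _ _ N.+1) => n Nn.
rewrite -EFinD lee_fin ler_pdivrMr ?ltr0n ?(leq_ltn_trans _ Nn) //.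
apply: le_trans (ltW (HN n (ltnW Nn))) _; apply: ler_wpM2r => //.
by rewrite lerD2l.
Qed.

End ThresholdFrequency.

(** * A lower bound for the cost by a potential function *)

(** Integrals of nonnegative functions are suprema over the simple functions
    below, so they can be compared without measurability. *)
Lemma ge0_integral_mono (R : realType) (d : measure_display) (T : measurableType d)
    (mu : {measure set T -> \bar R}) (f g : T -> \bar R) :
  (forall w, (0 <= f w)%E) -> (forall w, (f w <= g w)%E) ->
  (\int[mu]_w f w <= \int[mu]_w g w)%E.
Proof.
move=> f0 fg; rewrite !ge0_integralTE //; last by move=> w; exact: le_trans (fg w).
apply: ereal_sup_le => _ [k /= kf <-].
by exists k => // w; exact: le_trans (kf w) (fg w).
Qed.

Section CostLowerBound.
Context (R : realType) (d : measure_display) (T : measurableType d).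
Variables (P : probability T R) (alpha : R) (xi D : nat -> T -> bool) (G : nat -> set (set T)).
Hypothesis DP : decision_process P alpha xi D G.
Variables (h c : nat -> R) (g gamma r H C : R).
Hypotheses (alpha01 : 0 < alpha < 1) (h0 : forall q, 0 <= h q <= H)
  (c0 : forall q, 0 <= c q <= C) (cq : forall q, c q <= q%:R)
  (gamma0 : 0 <= gamma) (r0 : 0 <= r).
(* [gamma] is the price of a deletion: by [jump_le] a deletion never beats its
   price, so [potential], which is about the chain without deletions, bounds the
   priced cost of every policy. *)
Hypotheses (jump_le : forall q, h q.+1 - h q <= gamma)
  (potential : forall q, g <= c q + alpha * (h q.+1 - h q) + (1 - alpha) * (h q.-1 - h q)).

Local Notation Q := (queue_at xi D).
Local Notation K := (deleted_by D).

Let priced_total N w := h (Q N w) + gamma * (K N w)%:R + \sum_(n < N) c (Q n w).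

Let state_rv' n (F : nat -> nat -> R) : bounded_rv (fun w => F (Q n w) (K n w)) := state_rv DP n F.

Let sum_rv N : bounded_rv (fun w => \sum_(n < N) c (Q n w)).
Proof. by apply: bounded_rv_sum => n; exact: (state_rv' n (fun q _ => c q)). Qed.

Let priced_total_rv N : bounded_rv (priced_total N).
Proof.
by apply: bounded_rvD (sum_rv N); exact: (state_rv' N (fun q k => h q + gamma * k%:R)).
Qed.

(** By [jump_le], deleting an arrival increases the priced total by at least as
    much as letting the arrival in, in which case [potential] gives the drift. *)
Lemma potential_growth N : N%:R * g <= Ex P (priced_total N).
Proof.
elim: N => [|N IH].
  rewrite mul0r; apply: le_trans (_ : Ex P (fun=> 0) <= _); first by rewrite Ex_cst.
  apply: Ex_le => //; first exact: bounded_rv_cst.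
  move=> w; rewrite /priced_total big_ord0 addr0 addr_ge0 ?mulr_ge0 //.
  by have /andP[] := h0 (Q 0 w).
pose F1 q k := h q.+1 + gamma * k%:R.
pose F2 q k := h q.-1 + gamma * k%:R.
pose S w := \sum_(n < N.+1) c (Q n w).
have rif : bounded_rv (fun w => if xi N.+1 w then F1 (Q N w) (K N w) else F2 (Q N w) (K N w)).
  rewrite (_ : (fun _ => _) = fun w => (xi N.+1 w)%:R * (F1 (Q N w) (K N w) - F2 (Q N w) (K N w))
      + F2 (Q N w) (K N w)); last by apply/funext => w; case: (xi _ _) => /=; ring.
  apply: bounded_rvD (state_rv' N F2); apply: bounded_rvM; first exact: (arrival_rv DP).
  exact: (state_rv' N (fun q k => F1 q k - F2 q k)).
have rmean := state_rv' N (fun q k => alpha * F1 q k + (1 - alpha) * F2 q k).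
apply: le_trans (_ : Ex P (fun w => (if xi N.+1 w then F1 (Q N w) (K N w) else F2 (Q N w) (K N w)) + S w) <= _).
  rewrite ExD //; last exact: sum_rv.
  rewrite (Ex_step DP N F1 F2) -ExD //; last exact: sum_rv.
  rewrite -natr1 mulrDl mul1r.
  apply: le_trans (_ : Ex P (priced_total N) + Ex P (fun=> g) <= _); first by rewrite Ex_cst lerD2r.
  rewrite -ExD //; last exact: bounded_rv_cst.
  apply: Ex_le; first by apply: bounded_rvD => //; exact: bounded_rv_cst.
    by apply: bounded_rvD => //; exact: sum_rv.
  move=> w; rewrite /priced_total /S big_ord_recr /= /F1 /F2.
  rewrite -subr_ge0; set s := \sum_(_ < _) _; have := potential (Q N w).
  rewrite -subr_ge0; congr (0 <= _); ring.
apply: Ex_le => //; first by apply: bounded_rvD => //; exact: sum_rv.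
move=> w; rewrite /priced_total /S lerD2r deleted_byS natrD {3}/queue_at /= -/(Q N w) /F1 /F2.
have := jump_le (Q N w); rewrite mulrDr; set gk := gamma * (K N w)%:R; case: (xi _ _); case: (D _ _) => /=; rewrite ?mulr1 ?mulr0 => jl; move: gamma0; lra.
Qed.

Let priced_average N w := (\sum_(1 <= k < N.+1) c (Q k w) + gamma * (K N w)%:R) / N%:R.

Let priced_average_rv N : bounded_rv (priced_average N).
Proof.
rewrite (_ : priced_average N = fun w => N%:R^-1 * (\sum_(1 <= k < N.+1) c (Q k w) + gamma * (K N w)%:R)); last first.
  by apply/funext => w; rewrite mulrC.
apply: bounded_rvZ; apply: bounded_rvD.
  by apply: bounded_rv_sum => n; exact: (state_rv' n (fun q _ => c q)).
exact: (state_rv' N (fun _ k => gamma * k%:R)).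
Qed.

Lemma Ex_running_cost N : (0 < N)%N -> g - H / N%:R <= Ex P (priced_average N).
Proof.
move=> N0; have N0' : 0 < N%:R :> R by rewrite ltr0n.
rewrite -(ler_pM2l N0') -ExZ //.
have -> : N%:R * (g - H / N%:R) = N%:R * g - H by field; rewrite gt_eqF.
apply: le_trans (_ : Ex P (priced_total N) + Ex P (fun=> - H) <= _).
  by rewrite Ex_cst lerD2r potential_growth.
rewrite -ExD //; last exact: bounded_rv_cst.
apply: Ex_le; [by apply: bounded_rvD => //; exact: bounded_rv_cst|exact: bounded_rvZ|].
move=> w; rewrite /priced_total /priced_average [leRHS]mulrC divfK ?gt_eqF //.
have : \sum_(n < N) c (Q n w) <= \sum_(1 <= k < N.+1) c (Q k w).
  have c00 : c 0%N = 0 by apply/eqP; rewrite eq_le cq; case/andP: (c0 0%N) => ->.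
  case: N N0 {N0'} => // N _; rewrite big_ord_recl /= [c _]c00 add0r.
  rewrite big_add1 /= big_mkord [leRHS]big_ord_recr /= -[leLHS]addr0.
  by apply: lerD => //; case/andP: (c0 (Q N.+1 w)).
have /andP[_ hH] := h0 (Q N w); lra.
Qed.

Let B := C + gamma.

Let priced_average_bound N w : 0 <= priced_average N w <= B.
Proof.
rewrite /priced_average; case: (posnP N) => [->|N0].
  rewrite invr0 mulr0 lexx /= addr_ge0 //.
  by have /andP[a b] := c0 0%N; exact: le_trans a b.
have N0' : 0 < N%:R :> R by rewrite ltr0n.
apply/andP; split.
  rewrite divr_ge0 // addr_ge0 ?mulr_ge0 //.
  by apply: sumr_ge0 => k _; case/andP: (c0 (Q k w)).
rewrite ler_pdivrMr // mulrDl lerD //.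
  apply: le_trans (_ : \sum_(1 <= k < N.+1) C <= _).
    by apply: ler_sum => k _; case/andP: (c0 (Q k w)).
  by rewrite sumr_const_nat subn1 mulr_natr.
by rewrite ler_wpM2l // ler_nat deleted_by_le.
Qed.

Let psi w := limn_esup (fun N => (priced_average N w)%:E).

Let psi_bound w : (0 <= psi w <= B%:E)%E.
Proof.
apply/andP; split; last first.
  apply: (@limn_esup_le _ _ _ 0%N) => n _; rewrite lee_fin; by case/andP: (priced_average_bound n w).
rewrite leNgt; apply/negP => /limn_esup_lt[N /(_ N (leqnn N))].
by rewrite lte_fin ltNge; case/andP: (priced_average_bound N w) => ->.
Qed.

Let psi_fin w : psi w = (fine (psi w))%:E.
Proof. by rewrite fineK //; case/andP: (psi_bound w) => a b; case: (psi w) a b. Qed.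

Let psi_rv : bounded_rv (fun w => fine (psi w)).
Proof.
split.
  apply: measurableT_comp => //; apply: measurable_fun_limn_esup => N.
  by apply/measurable_EFinP; case: (priced_average_rv N).
exists B => w; have := psi_bound w; rewrite psi_fin !lee_fin => /andP[a b].
by rewrite ger0_norm.
Qed.

(** Fatou's lemma in reverse: the truncated averages are bounded by [B]. *)
Lemma Ex_limsup_cost : g <= Ex P (fun w => fine (psi w)).
Proof.
have rB N : bounded_rv (fun w => B - priced_average N w).
  by apply: bounded_rvD; [exact: bounded_rv_cst|rewrite (_ : (fun _ => _) = fun w => -1 * priced_average N w);
    [exact: bounded_rvZ|apply/funext => w; rewrite mulN1r]].
have mB N : measurable_fun setT (fun w => (B - priced_average N w)%:E).
  by apply/measurable_EFinP; case: (rB N).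
have pB N w : setT w -> (0 <= (B - priced_average N w)%:E)%E.
  by move=> _; rewrite lee_fin subr_ge0; case/andP: (priced_average_bound N w).
have := @fatou _ _ _ P setT measurableT (fun N w => (B - priced_average N w)%:E) mB pB.
have -> : (\int[P]_w limn_einf (fun N => (B - priced_average N w)%:E) = (Ex P (fun w => B - fine (psi w)))%:E)%E.
  rewrite Ex_integral; last first.
    apply: bounded_rvD; first exact: bounded_rv_cst.
    rewrite (_ : (fun _ => _) = fun w => -1 * fine (psi w)); first exact: bounded_rvZ.
    by apply/funext => w; rewrite mulN1r.
  apply: eq_integral => w _.
  rewrite (_ : (fun N => _) = fun N => (B%:E + (- (priced_average N w)%:E))%E) // limn_einf_shift //.
  by rewrite (_ : (fun N => _) = -%E \o (fun N => (priced_average N w)%:E)) // limn_einfN -/(psi w) psi_fin.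
move=> fat; rewrite -(lerD2l (- B)) -subr_ge0.
have -> : - B + Ex P (fun w => fine (psi w)) - (- B + g) = (B - g) - Ex P (fun w => B - fine (psi w)).
  rewrite (_ : (fun w => B - fine (psi w)) = fun w => B + (-1) * fine (psi w)); last first.
    by apply/funext => w; rewrite mulN1r.
  rewrite ExD ?ExZ ?Ex_cst //; [ring|exact: bounded_rv_cst|exact: bounded_rvZ].
rewrite subr_ge0 -lee_fin; apply: le_trans fat _.
apply: le_trans (limn_einf_sup _) _; apply/lee_addgt0Pr => eps eps0.
have [N0 HN0] : exists N0 : nat, forall N, (N0 < N)%N -> H / N%:R <= eps.
  exists (Num.truncn (H / eps)) => N NN; have N0 : 0 < N%:R :> R by rewrite ltr0n (leq_ltn_trans _ NN).
  rewrite ler_pdivrMr // mulrC -ler_pdivrMr // ltW //.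
  by apply: lt_le_trans (truncnS_gt _) _; rewrite ler_nat.
apply: (@limn_esup_le _ _ _ N0.+1) => N NN.
rewrite -Ex_integral // -EFinD lee_fin.
rewrite (_ : (fun w => B - priced_average N w) = fun w => B + (-1) * priced_average N w); last first.
  by apply/funext => w; rewrite mulN1r.
rewrite ExD ?ExZ ?Ex_cst //; [|exact: bounded_rv_cst|exact: bounded_rvZ].
have := Ex_running_cost (leq_ltn_trans (leq0n _) NN); have := HN0 N NN; lra.
Qed.

(** Almost surely the deletions contribute at most gamma * r to the priced cost.
    The function [phi] is only known almost surely, hence need not be measurable;
    a measurable minorant is integrated instead. *)
Lemma cost_lower_bound (phi : T -> \bar R) : (forall w, (0 <= phi w)%E) ->
  {ae P, forall w, (limn_esup (fun n => ((K n w)%:R / n%:R)%:E) <= r%:E)%E} ->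
  {ae P, forall w, phi w = avg_queue R (Q^~ w)} ->
  ((g - gamma * r)%:E <= \int[P]_w phi w)%E.
Proof.
move=> phi0 freq cost.
pose psi' w := Num.max 0 (fine (psi w) - gamma * r).
have psi'_rv : bounded_rv psi'.
  case: psi_rv => mpsi [Cp pC]; split.
    apply: measurable_maxr => //; apply: measurable_funB => //.
  exists (Cp + gamma * r) => w; rewrite /psi' ger0_norm ?le_max ?lexx //.
  have /(le_trans (ler_norm _)) := pC w; have : 0 <= gamma * r by rewrite mulr_ge0.
  have := le_trans (normr_ge0 _) (pC w).
  by rewrite ge_max => a b cc; apply/andP; split; lra.
have le_phi : {ae P, forall w, ((psi' w)%:E <= phi w)%E}.
  move: freq cost; apply: filterS2 => w Kr phiE.
  rewrite /psi' EFin_max ge_max phi0 /= EFinB leeBlDr // -psi_fin.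
  have [->|nfin] := eqVneq (phi w) +oo%E; first by rewrite addye ?leey.
  have phif : phi w \is a fin_num by rewrite ge0_fin_numE // ltey.
  apply/lee_addgt0Pr => eps eps0.
  pose e := eps / (1 + gamma).
  have g1 : 0 < 1 + gamma by move: gamma0; lra.
  have e0 : 0 < e by rewrite divr_gt0.
  have re : (r%:E < (r + e)%:E)%E by rewrite lte_fin ltrDl.
  have [N1 H1] := limn_esup_lt (le_lt_trans Kr re).
  have [|N2 H2] := @limn_esup_lt _ (fun n => ((\sum_(1 <= k < n.+1) Q k w)%:R / n%:R)%:E) (phi w + e%:E)%E.
    by rewrite -/(avg_queue R (Q^~ w)) -phiE lteDl // lte_fin.
  apply: (@limn_esup_le _ _ _ (maxn N1 N2).+1) => n nN.
  have n0 : 0 < n%:R :> R by rewrite ltr0n (leq_ltn_trans _ nN).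
  have := H1 n ltac:(by rewrite (leq_trans _ (ltnW nN)) // leq_maxl).
  have := H2 n ltac:(by rewrite (leq_trans _ (ltnW nN)) // leq_maxr).
  rewrite -(fineK phif) -!EFinD !lte_fin lee_fin => A1 A2.
  have A3 : \sum_(1 <= k < n.+1) c (Q k w) <= (\sum_(1 <= k < n.+1) Q k w)%:R.
    by rewrite natr_sum; apply: ler_sum.
  have A4 : priced_average n w <= (\sum_(1 <= k < n.+1) Q k w)%:R / n%:R + gamma * ((K n w)%:R / n%:R).
    by rewrite /priced_average mulrDl mulrA lerD2r ler_pM2r ?invr_gt0.
  have A5 : gamma * ((K n w)%:R / n%:R) <= gamma * (r + e) by apply: ler_wpM2l => //; exact: ltW.
  have A6 : eps = e + gamma * e by rewrite /e; field; rewrite gt_eqF.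
  apply: le_trans A4 _; rewrite A6.
  move: A1 A5; rewrite mulrDr; set y := gamma * (_ / _); set z := _ / _; lra.
have [N [mN PN subN]] := le_phi.
pose low w := psi' w * \1_(~` N) w.
have psi'0 w : 0 <= psi' w by rewrite le_max lexx.
have mlow : measurable_fun setT low.
  apply: measurable_funM; first by case: psi'_rv.
  by apply: measurable_indic; exact: measurableC.
have low_phi w : ((low w)%:E <= phi w)%E.
  rewrite /low indicE; case: (boolP (w \in ~` N)) => wN /=; last by rewrite mulr0 phi0.
  rewrite mulr1; apply: contrapT => nle; move: wN; rewrite inE /=; apply.
  exact: subN.
apply: le_trans (_ : (\int[P]_w (low w)%:E <= _)%E); last first.
  apply: ge0_integral_mono => // w; rewrite lee_fin mulr_ge0 //.
rewrite (@ge0_ae_eq_integral _ _ _ P setT (fun w => (low w)%:E) (fun w => (psi' w)%:E)) //.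
- rewrite -Ex_integral // lee_fin.
  apply: le_trans (_ : Ex P (fun w => fine (psi w) + (- (gamma * r))) <= _).
    rewrite ExD //; last exact: bounded_rv_cst.
    by rewrite Ex_cst lerD2r Ex_limsup_cost.
  apply: Ex_le => //; first by apply: bounded_rvD => //; exact: bounded_rv_cst.
  by move=> w; rewrite le_max lexx orbT.
- exact/measurable_EFinP.
- by apply/measurable_EFinP; case: psi'_rv.
- by move=> w _; rewrite lee_fin mulr_ge0.
- by move=> w _; rewrite lee_fin.
- exists N; split => // w /= nw; apply: contrapT => wN; apply: nw => _.
  by rewrite /low indicE mem_set ?mulr1.
Qed.

End CostLowerBound.

(** * Online policies as controlled chains *)

Section PolicyProcess.
Context (R : realType) (p lam : R) (X : queue_model R).
Hypothesis V : valid_model p lam X.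
Hypotheses (hp : 0 < p < 1) (hlam : 0 < lam < 1).
Variable pol : policy R.

Local Notation path_of o := (@sample_path R X o).
Local Notation Om := (model_space X * seed pol)%type.

Definition joint_probability : probability Om R :=
  (model_law X \x seed_law pol)%E.

Definition arrival_at n (z : Om) : bool := event_is_arrival (path_of z.1) n.
Definition deleted_at n (z : Om) : bool :=
  `[< slots (deletions pol (path_of z.1) z.2) n >].
Definition seeded_history n : set (set Om) := @with_seed R X pol (event_history n).

Definition adapted : Prop := forall n, (0 < n)%N ->
  seeded_history n [set z | slots (deletions pol (path_of z.1) z.2) n].

Lemma seeded_history_rect n E : event_history n E ->
  seeded_history n [set z | E z.1].
Proof.
move=> HE; apply: sub_sigma_algebra; exists E, setT; split => //.
by apply/seteqP; split=> z //= [].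
Qed.

(** The seed being independent of the path, the rule for the next event holds on
    rectangles, a pi-system generating the history enriched with the seed. *)
Lemma decision_process_adapted : adapted ->
  decision_process joint_probability (lam / (lam + 1 - p)) arrival_at deleted_at seeded_history.
Proof.
move=> ad.
have arr n := event_history_is_arrival V (ltn0Sn n).
have rmeas n : [set F | exists E H, [/\ event_history n E, measurable H & F = E `*` H]] `<=` 
    (@measurable _ Om).
  by move=> _ [E [H [HE mH ->]]]; apply: measurableX => //; exact: (event_history_measurable V HE).
split.
- by move=> n; exact: gen_salg.
- by move=> n; apply: smallest_sub; [exact: sigma_algebra_measurable|exact: rmeas].
- move=> n; apply: sub_sigma_algebra2 => _ [E [H [HE mH ->]]].
  by exists E, H; split => //; exact: (event_history_mono V (leqnSn n)).
- by move=> n; exact: (seeded_history_rect (arr n)).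
- move=> n; rewrite (_ : [set _ | _] = [set z | slots (deletions pol (path_of z.1) z.2) n.+1]).
    exact: ad.
  by apply/seteqP; split=> z /=; rewrite /deleted_at => /asboolP.
move=> n E HE.
have PT (F : set (model_space X)) (H : set (seed pol)) : measurable F -> measurable H ->
    joint_probability (F `*` H) = (model_law X F * seed_law pol H)%E.
  by move=> mF mH; exact: product_measure1E.
set xi := [set o | event_is_arrival (path_of o) n.+1].
have xiE : [set z | arrival_at n.+1 z] = xi `*` [set: seed pol].
  by apply/seteqP; split=> z //= [].
have mxi : measurable xi := event_history_measurable V (arr n).
have next F : event_history n F -> model_law X (F `&` xi) = ((lam / (lam + 1 - p))%:E * model_law X F)%E.
  exact: (next_event_arrival V hp hlam).
rewrite xiE; apply: (proj2 (@pi_lambda_independence _ _ _ joint_probability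
  [set F | exists E H, [/\ event_history n E, measurable H & F = E `*` H]] _ _ _ _ _ _ _ _ HE)).
- move=> _ _ [E1 [H1 [HE1 mH1 ->]]] [E2 [H2 [HE2 mH2 ->]]].
  exists (E1 `&` E2), (H1 `&` H2); split; [exact: (salgI (event_history_salg V n))|exact: measurableI|].
  by apply/seteqP; split=> z /= [] [? ?] [? ?].
- exact: rmeas.
- exact: measurableX.
- rewrite PT // probability_setT mule1 -(setTI xi) next ?probability_setT ?mule1 //.
  exact: salgT (event_history_salg V n).
move=> _ [F [H [HF mH ->]]].
have mF := event_history_measurable V HF.
rewrite (_ : _ `&` _ = (F `&` xi) `*` H); last first.
  by apply/seteqP; split=> z /=; [case=> -[? ?] [? _]|case=> -[? ?] ?].
by rewrite !PT // ?next ?muleA //; exact: measurableI.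
Qed.

Lemma feasible_queue z :
  feasible_deletion p lam (initial_queue (path_of z.1)) (deletions pol (path_of z.1) z.2) ->
  delete (initial_queue (path_of z.1)) (deletions pol (path_of z.1) z.2) =
  queue_at arrival_at deleted_at ^~ z.
Proof. by case=> _ inj sub _; apply/funext => n; rewrite deleteE. Qed.

Lemma feasible_frequency z :
  feasible_deletion p lam (initial_queue (path_of z.1)) (deletions pol (path_of z.1) z.2) ->
  (limn_esup (fun n => ((deleted_by deleted_at n z)%:R / n%:R)%:E) <= (p / (lam + 1 - p))%:E)%E.
Proof. by case. Qed.

Lemma avg_queue_ge0 (Q : nat -> nat) : (0 <= avg_queue R Q)%E.
Proof.
rewrite leNgt; apply/negP => /limn_esup_lt[N /(_ N (leqnn N))].
by rewrite lte_fin ltNge divr_ge0.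
Qed.

Hypothesis hgt : 1 - p < lam.

(** Test the truncated cost [c], which is 0 below level m. The increments [Dl] of
    the potential solve alpha Dl(q) - beta Dl(q - 1) = g below m, where g is
    chosen such that the value gamma reached at m - 1 can be kept above m: this
    needs m + (alpha - beta) gamma = g, that is, g = m sigma ^ m. From a high
    level K on, the cost alone exceeds g + beta gamma, and the increments may
    vanish; the potential is then bounded. The value g - gamma r of the resulting
    bound is the stated one. *)
Lemma online_cost_lower_bound (m : nat) : (0 < m)%N -> feasible_policy p lam X pol -> adapted ->
  ((m%:R * (p - (1 - lam) * (lam / (1 - p)) ^+ m) / (lam - (1 - p)))%:E <= cost X pol)%E.
Proof.
move=> m0 feas ad.
have [p0 p1] := andP hp; have [l0 l1] := andP hlam.
have q0 : 0 < 1 - p by lra.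
pose mu := lam + 1 - p; have mu0 : 0 < mu by rewrite /mu; lra.
pose alpha := lam / mu; pose beta := (1 - p) / mu; pose rho := (1 - p) / lam.
have alpha0 : 0 < alpha by rewrite divr_gt0.
have beta0 : 0 < beta by rewrite divr_gt0.
have betaE : 1 - alpha = beta by rewrite /alpha /beta /mu; field; rewrite gt_eqF.
have alpha1 : alpha < 1 by rewrite -subr_gt0 betaE.
have rho0 : 0 < rho by rewrite divr_gt0.
have rho1 : rho < 1 by rewrite ltr_pdivrMr // mul1r.
have arb : alpha * rho = beta by rewrite /alpha /rho /beta; field; rewrite !gt_eqF.
pose g := m%:R * (lam / (1 - p)) ^+ m.
have g0 : 0 < g by rewrite mulr_gt0 ?ltr0n // exprn_gt0 // divr_gt0.
have grho : g * rho ^+ m = m%:R.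
  rewrite /g -mulrA -exprMn (_ : _ * rho = 1) ?expr1n ?mulr1 // /rho.
  by field; rewrite !gt_eqF.
pose geo n := \sum_(j < n) rho ^+ j.
have geoS n : geo n.+1 = 1 + rho * geo n.
  by rewrite /geo big_ord_recl expr0 mulr_sumr; congr (_ + _); apply: eq_bigr => j _; rewrite exprS.
have geo_mono n n' : (n <= n')%N -> geo n <= geo n'.
  move=> /subnK <-; elim: (n' - n)%N => [|k IH]; first by rewrite add0n.
  by rewrite addSn /geo big_ord_recr /=; apply: le_trans IH _; rewrite lerDl exprn_ge0 // ltW.
have geo0 : geo 0%N = 0 by rewrite /geo big_ord0.
have geo_ge0 n : 0 <= geo n by rewrite -geo0 geo_mono.
have geoE n : (1 - rho) * geo n = 1 - rho ^+ n.
  by elim: n => [|n IH]; rewrite ?geo0 ?mulr0 ?expr0 ?subrr // geoS mulrDr mulrCA IH exprS; ring.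
pose gamma := g / alpha * geo m.
have gamma0 : 0 <= gamma by rewrite mulr_ge0 // divr_ge0 // ltW.
pose K := maxn m (Num.truncn (g + beta * gamma)).+1.
have mK : (m <= K)%N by rewrite leq_maxl.
have KK : g + beta * gamma <= K%:R.
  by apply: le_trans (ltW (truncnS_gt _)) _; rewrite ler_nat leq_maxr.
pose Dl q := if (q < K)%N then g / alpha * geo (minn q.+1 m) else 0.
have Dl0 q : 0 <= Dl q by rewrite /Dl; case: ifP => // _; rewrite mulr_ge0 // divr_ge0 // ltW.
have Dlg q : Dl q <= gamma.
  rewrite /Dl; case: ifP => // _; apply: ler_wpM2l; first by rewrite divr_ge0 // ltW.
  by apply: geo_mono; rewrite geq_minr.
pose h q := \sum_(i < q) Dl i.
have hS q : h q.+1 - h q = Dl q by rewrite /h big_ord_recr /= addrAC subrr add0r.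
pose c q : R := if (q < m)%N then 0 else if (q < K)%N then m%:R else K%:R.
have DP := decision_process_adapted ad.
pose r := p / mu.
have -> : m%:R * (p - (1 - lam) * (lam / (1 - p)) ^+ m) / (lam - (1 - p)) = g - gamma * r.
  have lp : lam - (1 - p) != 0 by rewrite subr_eq0 gt_eqF.
  have e1 : geo m = (1 - rho ^+ m) / (1 - rho).
    by rewrite -geoE mulrAC divff ?mul1r // subr_eq0 gt_eqF.
  have e2 : gamma * r = (g - m%:R) * p / (lam - (1 - p)).
    rewrite -grho /gamma e1 /r /alpha /rho; field.
    by rewrite lp !gt_eqF.
  by rewrite e2 /g; field.
apply: (@cost_lower_bound _ _ _ joint_probability alpha arrival_at deleted_at seeded_history DP
   h c g gamma r (\sum_(i < K) Dl i) K%:R) => //.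
- move=> q; rewrite sumr_ge0 //=.
  elim: q => [|q IH]; first by rewrite /h big_ord0 sumr_ge0.
  have [qK|Kq] := ltnP q K; last first.
    by move: (hS q) => /eqP; rewrite /Dl ltnNge Kq subr_eq0 => /eqP ->.
  have cat := @big_cat_nat R 0 +%R q.+1 0%N K predT Dl (leq0n _) qK.
  rewrite /h -!(big_mkord predT Dl); rewrite cat /= lerDl; exact: sumr_ge0.
- move=> q; rewrite /c; case: ifP => _; first by rewrite lexx ler0n.
  by case: ifP => _; rewrite ler0n ?lexx // ler_nat.
- move=> q; rewrite /c; case: ltnP => qm; first exact: ler0n.
  by case: ltnP => Kq; rewrite ler_nat.
- by rewrite divr_ge0 // ltW.
- by move=> q; rewrite hS.
- move=> q; rewrite hS betaE.
  have -> : h q.-1 - h q = if q is q'.+1 then - Dl q' else 0.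
    by case: q => [|q] /=; rewrite ?subrr // -hS opprB.
  rewrite /c; case: ltnP => qm.
    have qK : (q < K)%N by exact: leq_trans qm mK.
    rewrite /Dl qK (minn_idPl qm) geoS.
    case: q qm qK => [|q] qm qK.
      by rewrite geo0 mulr0 addr0 mulr0 addr0 mulr1 mulrCA divff ?gt_eqF // mulr1 add0r.
    rewrite (ltnW qK) (minn_idPl (ltnW qm)) -arb.
    rewrite le_eqVlt; apply/orP; left; apply/eqP; field.
    by rewrite gt_eqF.
  have bD : beta * gamma <= K%:R - g by lra.
  case: q qm => [|q] qm; first by move: (leq_trans m0 qm).
  case: ltnP => qK.
    rewrite {1}/Dl qK (minn_idPr (leqW qm)) -/gamma.
    apply: le_trans (_ : m%:R + (alpha - beta) * gamma <= _).
      have -> : (alpha - beta) * gamma = g * (1 - rho ^+ m).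
        by rewrite -geoE -arb /gamma; field; rewrite gt_eqF.
      by rewrite mulrBr grho mulr1; lra.
    by have := ler_wpM2l (ltW beta0) (Dlg q); lra.
  rewrite {1}/Dl ltnNge qK /=.
  by have := ler_wpM2l (ltW beta0) (Dlg q); lra.
- by move=> z; exact: avg_queue_ge0.
- move: feas; apply: filterS => z; exact: feasible_frequency.
- by move: feas; apply: filterS => z /feasible_queue ->.
Qed.

End PolicyProcess.

(** * The threshold policy is online and feasible *)

Section ThresholdPolicy.
Context (R : realType) (p lam : R) (X : queue_model R).
Hypothesis V : valid_model p lam X.
Hypotheses (hp : 0 < p < 1) (hlam : 0 < lam < 1).

Local Notation path_of o := (@sample_path R X o).

Lemma onlineE (pol : policy R) :
  online p lam X pol <-> feasible_policy p lam X pol /\ adapted X pol.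
Proof.
have eqH n : filtration_at (fun o => event_time (path_of o) n + 0)%E = event_history (X := X) n.
  by rewrite /event_history; congr filtration_at; apply/funext => o; rewrite adde0.
by split=> -[feas ad]; split => // n n0; have := ad n n0; rewrite /seeded_history eqH.
Qed.

Lemma threshold_adapted (L : int) : adapted X (threshold_policy R L).
Proof.
pose th o := threshold_deletes L (path_of o).
pose q n o := controlled_queue (event_is_arrival (path_of o)) (th o) n.
have arr n := event_history_is_arrival V (ltn0Sn n).
have qH n k : event_history n [set o | q n o = k].
  elim: n k => [|n IH] k.
    rewrite (_ : [set _ | _] = if 0%N == k then setT else set0).
      by case: ifP => _; [exact: salgT (event_history_salg V 0)|exact: salg0 (event_history_salg V 0)].
    by apply/seteqP; split=> o; rewrite /q /=; case: eqP.
  have sH := event_history_salg V n.+1.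
  pose Z o := (q n o, event_is_arrival (path_of o) n.+1).
  pose next (z : nat * bool) := if z.2 then (if (L <= z.1%:Z)%R then z.1 else z.1.+1) else z.1.-1.
  rewrite (_ : [set _ | _] = [set o | next (Z o) = k]); last first.
    apply/seteqP; split=> o; rewrite /q /Z /next /= /th threshold_deletesE -/(th o) -/(q n o);
      by case: event_is_arrival.
  apply: (@salg_fibres _ _ sH _ Z (fun z => next z = k)) => -[j b].
  rewrite (_ : [set _ | _] = [set o | q n o = j] `&` [set o | event_is_arrival (path_of o) n.+1 = b]).
    apply: (salgI sH); first by apply: (event_history_mono V (leqnSn n)); exact: IH.
    exact: (@salg_bool _ _ sH (fun o => event_is_arrival (path_of o) n.+1) (fun c => c = b) (arr n)).
  by apply/seteqP; split=> o; [case=> h1 h2; split|case=> /= <- <-].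
move=> [//|n] _.
rewrite (_ : [set _ | _] = [set z | [set o | th o n.+1] z.1]); last first.
  by apply/seteqP; split=> z; rewrite /= slots_threshold_policy.
apply: seeded_history_rect.
have sH := event_history_salg V n.+1.
rewrite (_ : [set _ | _] = [set o | event_is_arrival (path_of o) n.+1] `&` [set o | (L <= (q n o)%:Z)%R]).
  apply: (salgI sH) => //.
  apply: (@salg_fibres _ _ sH _ (q n) (fun k => (L <= k%:Z)%R)) => k.
  by apply: (event_history_mono V (leqnSn n)); exact: qH.
by apply/seteqP; split=> o; rewrite /= /th threshold_deletesE; [case/andP|case=> -> ->].
Qed.

Lemma threshold_cost_le (L : int) : 0 <= L ->
  (0 <= cost X (threshold_policy R L) <= (L%:~R)%:E)%E.
Proof.
move=> L0; set pol := threshold_policy R L.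
have avg z : (avg_queue R (delete (initial_queue (path_of z.1)) (deletions pol (path_of z.1) z.2)) <= (L%:~R)%:E)%E.
  apply: (@limn_esup_le _ _ _ 1%N) => n n0; rewrite lee_fin.
  rewrite ler_pdivrMr ?ltr0n // natr_sum.
  apply: le_trans (_ : \sum_(1 <= k < n.+1) (L%:~R : R) <= _).
    apply: ler_sum => k _; rewrite threshold_policy_queue [leLHS]pmulrn ler_int.
    exact: threshold_queue_le.
  by rewrite sumr_const_nat subn1 mulr_natr.
apply/andP; split; first by apply: integral_ge0 => z _; exact: avg_queue_ge0.
apply: le_trans (_ : (\int[joint_probability X pol]_z (L%:~R)%:E <= _)%E).
  by apply: ge0_integral_mono => // z; exact: avg_queue_ge0.
rewrite (_ : (\int[_]_z _)%E = ((L%:~R)%:E * joint_probability X pol setT)%E).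
  by rewrite probability_setT mule1.
exact: integral_cst.
Qed.

Hypothesis hgt : 1 - p < lam.

Lemma threshold_level_gt0 : 0 < threshold_level p lam.
Proof.
have [p0 p1] := andP hp; have [l0 l1] := andP hlam.
rewrite /threshold_level ceil_gt0.
by apply: divr_gt0; apply: ln_gt0; rewrite ltr_pdivlMr; move: hgt; lra.
Qed.

Lemma threshold_level_pow (L : nat) : threshold_level p lam = L%:Z ->
  ((1 - p) / lam) ^+ L <= (1 - lam) / p.
Proof.
have [p0 p1] := andP hp; have [l0 l1] := andP hlam => LE.
have q0 : 0 < 1 - p by lra.
have d0 : 0 < 1 - lam by lra.
have s0 : 0 < lam / (1 - p) by rewrite divr_gt0.
have lns : 0 < ln (lam / (1 - p)) by rewrite ln_gt0 // ltr_pdivlMr // mul1r.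
have := ceil_ge (log_base (lam / (1 - p)) (p / (1 - lam))).
rewrite -/(threshold_level p lam) LE /log_base -pmulrn ler_pdivrMr // => le.
rewrite -[leLHS]invrK -[leRHS]invrK lef_pV2 ?posrE ?invr_gt0 ?exprn_gt0 ?divr_gt0 //.
rewrite -exprVn !invf_div -ler_ln ?posrE ?exprn_gt0 ?divr_gt0 // lnXn //.
by rewrite -mulr_natl.
Qed.

(** The potential has increments [Dl] with alpha Dl(q) - beta Dl(q - 1) = r, so
    its drift is exactly r below L. At L a deletion occurs with probability alpha
    and the drift is alpha - beta Dl(L - 1). By [threshold_level_pow], Dl(L - 1)
    is at least 1, and alpha - beta <= r because lam <= 1. *)
Lemma threshold_feasible : feasible_policy p lam X (threshold_policy R (threshold_level p lam)).
Proof.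
have [p0 p1] := andP hp; have [l0 l1] := andP hlam.
set pol := threshold_policy R _.
have LE : threshold_level p lam = `|threshold_level p lam|%N%:Z by rewrite gtz0_abs // threshold_level_gt0.
set L := `|threshold_level p lam|%N in LE.
have L0 : (0 < L)%N by have := threshold_level_gt0; rewrite LE ltz_nat.
have ad : adapted X pol by exact: threshold_adapted.
have DP := decision_process_adapted V hp hlam ad.
have q0 : 0 < 1 - p by lra.
pose mu := lam + 1 - p; have mu0 : 0 < mu by rewrite /mu; lra.
pose rho := (1 - p) / lam.
pose Dl n := p / lam * \sum_(j < n.+1) rho ^+ j.
pose h q := \sum_(i < q) Dl i.
have rho0 : 0 < rho by rewrite divr_gt0.
have hS q : h q.+1 - h q = Dl q by rewrite /h big_ord_recr /= addrAC subrr add0r.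
have DlS n : Dl n.+1 = p / lam + rho * Dl n.
  rewrite /Dl big_ord_recl expr0 mulrDr mulr1 [rho * _]mulrCA [rho * _]mulr_sumr; congr (_ + _ * _).
  by apply: eq_bigr => j _; rewrite exprS.
have Dl_ge0 n : 0 <= Dl n.
  apply: mulr_ge0; first by rewrite divr_ge0 // ltW.
  by apply: sumr_ge0 => j _; rewrite exprn_ge0 // ltW.
have Dl0 : Dl 0%N = p / lam by rewrite /Dl big_ord_recr big_ord0 /= add0r expr0 mulr1.
have freq : {ae joint_probability X pol, forall z,
    (limn_esup (fun n => ((deleted_by (@deleted_at R X pol) n z)%:R / n%:R)%:E) <= (p / mu)%:E)%E}.
  apply: (@threshold_frequency _ _ _ _ _ _ _ _ DP L _ h).
  - by rewrite divr_gt0 //= ltr_pdivrMr // mul1r /mu; lra.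
  - move=> n z; rewrite /deleted_at slots_threshold_policy.
    rewrite (_ : `[< _ >] = threshold_deletes (threshold_level p lam) (path_of z.1) n.+1); last first.
      by apply/asboolP/idP.
    rewrite threshold_deletesE LE lez_nat; congr (_ && (_ <= _)%N).
    apply: eq_controlled_queue => k _; rewrite /deleted_at slots_threshold_policy -LE.
    by apply/idP/asboolP.
  - by move=> q; apply: sumr_ge0 => i _.
  - move=> q _; rewrite hS; case: q => [|q] /=.
      rewrite subrr mulr0 addr0 Dl0 le_eqVlt; apply/orP; left; apply/eqP.
      by rewrite /mu; field; rewrite !gt_eqF.
    have -> : h q - h q.+1 = - Dl q by rewrite -hS opprB.
    rewrite DlS le_eqVlt; apply/orP; left; apply/eqP.
    by rewrite /rho /mu; field; rewrite !gt_eqF.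
  have -> : h L.-1 - h L = - Dl L.-1 by rewrite -hS opprB prednK.
  have rho1 : rho < 1 by rewrite ltr_pdivrMr // mul1r.
  have DlE : (1 - rho) * Dl L.-1 = p / lam * (1 - rho ^+ L).
    rewrite -(prednK L0) /=; elim: (L.-1) => [|n IH].
      by rewrite Dl0 expr1 mulrC.
    by rewrite DlS mulrDr [(1 - rho) * (rho * _)]mulrCA IH !exprS; ring.
  have Dl1 : 1 <= Dl L.-1.
    rewrite -(ler_pM2l (_ : 0 < 1 - rho)); last by rewrite subr_gt0.
    rewrite DlE mulr1; have := threshold_level_pow LE; rewrite -/rho => pw.
    apply: le_trans (_ : p / lam * (1 - (1 - lam) / p) <= _); last first.
      by apply: ler_wpM2l; [rewrite divr_ge0 // ltW|rewrite lerD2l lerN2].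
    rewrite le_eqVlt; apply/orP; left; apply/eqP; rewrite /rho.
    by field; rewrite !gt_eqF.
  rewrite (_ : 1 - lam / mu = (1 - p) / mu); last by rewrite /mu; field; rewrite gt_eqF.
  apply: le_trans (_ : lam / mu + (1 - p) / mu * (- 1) <= _).
    rewrite lerD2l; apply: ler_wpM2l; first by rewrite divr_ge0 // ltW.
    by rewrite lerN2.
  by rewrite mulrN1 -mulrBl ler_pM2r ?invr_gt0 //; lra.
move: freq; apply: filterS => z fr.
have [h1 h2 h3] := @threshold_policy_slots_ok R (threshold_level p lam) (path_of z.1) z.2.
by split.
Qed.

End ThresholdPolicy.

(** * Asymptotics as lam tends to 1 *)

Section Asymptotics.
Context (R : realType) (p : R).
Hypothesis hp : 0 < p < 1.
Let p0 : 0 < p. Proof. by case/andP: hp. Qed.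
Let p1 : p < 1. Proof. by case/andP: hp. Qed.
Let q0 : 0 < 1 - p. Proof. by rewrite subr_gt0. Qed.

Let kappa := - ln (1 - p).
Let kappa0 : 0 < kappa.
Proof. by rewrite oppr_gt0 ln_lt0 // q0 gtrBl. Qed.

Local Notation L0 lam := (log_base (1 / (1 - p)) (1 / (1 - lam))).

Lemma log_targetE lam : lam < 1 -> 1 - lam = expR (- (kappa * L0 lam)).
Proof.
move=> l1; have d0 : 0 < 1 - lam by rewrite subr_gt0.
rewrite /log_base !div1r !lnV ?posrE // mulrCA divff ?mulr1 ?gt_eqF //.
by rewrite opprK lnK.
Qed.

(** The base lam / (1 - p) of the logarithm defining the level differs from the
    limiting base by the factor lam, which costs a factor 1 + eps / 2; rounding
    up costs another eps / 4 once the target is at least 4 / eps. *)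
Lemma threshold_level_le (lam eps : R) : 1 - p < lam < 1 -> 0 < eps <= 1 ->
  4 / eps <= L0 lam -> expR (- (kappa * eps / 3)) <= lam ->
  (threshold_level p lam)%:~R <= (1 + eps) * L0 lam.
Proof.
move=> /andP[pl l1] /andP[e0 e1] M1 le.
have l0 : 0 < lam := lt_trans q0 pl.
have d0 : 0 < 1 - lam by rewrite subr_gt0.
have s1 : 1 < lam / (1 - p) by rewrite ltr_pdivlMr // mul1r.
have lns : ln (lam / (1 - p)) = ln lam + kappa by rewrite lnM ?posrE ?invr_gt0 // lnV.
have lns0 : 0 < ln lam + kappa by rewrite -lns ln_gt0.
have u : - (kappa * eps / 3) <= ln lam by rewrite -[leLHS]expRK ler_ln ?posrE ?expR_gt0.
set y := L0 lam in M1 *.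
have y0 : 0 < y by apply: lt_le_trans M1; rewrite divr_gt0.
have := ceilB1_lt (log_base (lam / (1 - p)) (p / (1 - lam))).
rewrite -/(threshold_level p lam) intrB ltrBlDr => /ltW/le_trans; apply.
apply: le_trans (_ : kappa * y / (ln lam + kappa) + 1 <= _).
  rewrite lerD2r /log_base lns ler_pM2r ?invr_gt0 //.
  rewrite lnM ?posrE ?invr_gt0 // lnV ?posrE //.
  have -> : - ln (1 - lam) = kappa * y by rewrite log_targetE // expRK opprK.
  by rewrite gerDr ltW // ln_lt0 // p0.
have a1 : 1 <= eps / 4 * y by move: M1; rewrite ler_pdivrMr //; lra.
have : kappa * y / (ln lam + kappa) <= (1 + eps / 2) * y.
  rewrite ler_pdivrMr // mulrAC ler_pM2r //.
  apply: le_trans (_ : (1 + eps / 2) * (kappa - kappa * eps / 3) <= _); last first.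
    by apply: ler_wpM2l; move: e0 u; lra.
  rewrite -subr_ge0 (_ : _ - _ = kappa * eps * (1 - eps) / 6); last by field.
  by rewrite divr_ge0 // mulr_ge0 ?subr_ge0 // mulr_ge0 // ltW.
have : 0 <= eps * y by rewrite mulr_ge0 // ltW.
by rewrite !mulrDl !mul1r; lra.
Qed.

(** Take for [m] the integer part of (1 - eps / 2) times the target: then
    (1 - lam) sigma ^ m is at most exp (- kappa eps L0 / 2), which is smaller
    than p eps / 4 once the target is large. *)
Lemma lower_bound_asymptotic (lam eps : R) : 1 - p < lam < 1 -> 0 < eps <= 1 ->
  4 / eps + 8 / (p * eps ^+ 2 * kappa) <= L0 lam ->
  exists2 m : nat, (0 < m)%N &
    (1 - eps) * L0 lam <= m%:R * (p - (1 - lam) * (lam / (1 - p)) ^+ m) / (lam - (1 - p)).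
Proof.
move=> /andP[pl l1] /andP[e0 e1] M1.
have l0 : 0 < lam := lt_trans q0 pl.
have d0 : 0 < 1 - lam by rewrite subr_gt0.
have pe0 : 0 < p * eps ^+ 2 * kappa by rewrite !mulr_gt0 // exprn_gt0.
have := log_targetE l1; set y := L0 lam in M1 * => yE.
have M2 : 4 / eps <= y by apply: le_trans M1; rewrite lerDl divr_ge0 // ltW.
have M3 : 8 / (p * eps ^+ 2 * kappa) <= y by apply: le_trans M1; rewrite lerDr divr_ge0 // ltW.
have y0 : 0 < y by apply: lt_le_trans M2; rewrite divr_gt0.
have a1 : 1 <= eps / 4 * y by move: M2; rewrite ler_pdivrMr //; lra.
pose z := (1 - eps / 2) * y.
have z0 : 0 <= z by rewrite mulr_ge0 ?ltW //; lra.
have y4 : 4 <= y by apply: le_trans M2; rewrite ler_pdivlMr //; lra.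
have [m [m1 mz zm]] : exists m : nat, [/\ (0 < m)%N, m%:R <= z & z < m%:R + 1].
  exists (Num.truncn z); split; [|by rewrite truncn_le|by rewrite natr1 truncnS_gt].
  rewrite truncn_gt0 /z; apply: le_trans (_ : (1 / 2) * y <= _); first by lra.
  by rewrite ler_pM2r //; lra.
exists m => //.
have pw : (1 - lam) * (lam / (1 - p)) ^+ m <= p * eps / 4.
  apply: le_trans (_ : expR (- (kappa * y)) * expR (kappa * m%:R) <= _).
    rewrite -yE ler_pM2l // expRM_natr lerXn2r ?nnegrE ?divr_ge0 ?expR_ge0 ?(ltW l0) ?(ltW q0) //.
    rewrite /kappa expRN lnK ?posrE //; apply: ler_piMl; last exact: ltW.
    by rewrite invr_ge0 ltW.
  rewrite -expRD; apply: le_trans (_ : expR (- (kappa * eps * y / 2)) <= _).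
    rewrite ler_expR -mulrN -mulrDr; apply: le_trans (_ : kappa * (- y + z) <= _).
      by rewrite ler_pM2l // lerD2l.
    by rewrite /z le_eqVlt; apply/orP; left; apply/eqP; field.
  have w0 : 0 < kappa * eps * y / 2.
    by apply: divr_gt0 => //; apply: mulr_gt0 => //; apply: mulr_gt0.
  have pe4 : 0 < p * eps / 4 by apply: divr_gt0 => //; apply: mulr_gt0.
  rewrite expRN invf_ple ?posrE ?expR_gt0 //.
  apply: le_trans (_ : 1 + kappa * eps * y / 2 <= _); last exact: expR_ge1Dx.
  apply: le_trans (_ : kappa * eps * y / 2 <= _); last by rewrite lerDr.
  have -> : (p * eps / 4)^-1 = kappa * eps / 2 * (8 / (p * eps ^+ 2 * kappa)).
    by field; rewrite !gt_eqF.
  have -> : kappa * eps * y / 2 = kappa * eps / 2 * y by field.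
  by rewrite ler_pM2l // divr_gt0 // mulr_gt0.
have lp0 : 0 < lam - (1 - p) by rewrite subr_gt0.
rewrite ler_pdivlMr //.
apply: le_trans (_ : (1 - eps) * y * p <= _).
  apply: ler_wpM2l; first by rewrite mulr_ge0 ?(ltW y0) // subr_ge0.
  by rewrite lerBlDr addrC subrK ltW.
apply: le_trans (_ : m%:R * (p - p * eps / 4) <= _); last first.
  by apply: ler_wpM2l => //; lra.
have -> : m%:R * (p - p * eps / 4) = m%:R * (1 - eps / 4) * p by field.
rewrite ler_pM2r //.
apply: le_trans (_ : (1 - 3 * eps / 4) * y * (1 - eps / 4) <= _); last first.
  apply: ler_wpM2r; first by lra.
  have : (1 - 3 * eps / 4) * y = z - eps / 4 * y by rewrite /z; field.
  by move=> ->; lra.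
rewrite -subr_ge0 (_ : _ - _ = 3 * eps ^+ 2 / 16 * y); last by field.
by rewrite mulr_ge0 ?(ltW y0) // divr_ge0 // mulr_ge0 // sqr_ge0.
Qed.

Lemma near_one_left (eps : R) : 0 < eps <= 1 ->
  \forall lam \near 1^'-, [/\ 1 - p < lam < 1,
    4 / eps + 8 / (p * eps ^+ 2 * kappa) <= L0 lam & expR (- (kappa * eps / 3)) <= lam].
Proof.
move=> /andP[e0 e1]; set M := 4 / eps + _.
pose eta := Num.min (expR (- (kappa * M))) (Num.min (1 - expR (- (kappa * eps / 3))) p).
have eta0 : 0 < eta.
  rewrite !lt_min expR_gt0 p0 subr_gt0 expR_lt1 oppr_lt0 andbT /=.
  by rewrite divr_gt0 // mulr_gt0.
apply/nbhs_ballP; exists eta => //= lam; rewrite /ball /= => lb l1.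
have d0 : 0 < 1 - lam by rewrite subr_gt0.
move: lb; rewrite (ger0_norm (ltW d0)) !lt_min => /and3P[h1 h2 h3].
split; first by apply/andP; split; [rewrite ltrBlDr addrC -ltrBlDr|exact: l1].
  by rewrite log_targetE // ltr_expR ltrN2 ltr_pM2l // in h1; exact: (ltW h1).
by move: h2; rewrite ltrBlDr addrC -ltrBlDr subKr => /ltW.
Qed.

Lemma asymp_at_1P (f g : R -> R) :
  (forall eps, 0 < eps <= 1 -> \forall lam \near 1^'-, `|1 - f lam / g lam| <= eps) ->
  asymp_at_1 f g.
Proof.
move=> H; apply/cvgrPdist_le => eps eps0.
have [e1|e1] := leP eps 1; first by apply: H; rewrite eps0.
have := H 1 ltac:(by rewrite ltr01 lexx).
by apply: filterS => lam /le_trans; apply; exact: ltW.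
Qed.

End Asymptotics.

Theorem theorem1 (R : realType) (p : R) (X : R -> queue_model R)
    (hp : 0 < p < 1)
    (hX : forall lam : R, 0 < lam < 1 -> valid_model p lam (X lam)) :
  let pi_th (lam : R) := threshold_policy R (threshold_level p lam) in
  (forall lam : R, 1 - p < lam < 1 ->
     feasible_policy p lam (X lam) (pi_th lam)) /\
  [/\ (forall lam : R, 1 - p < lam < 1 -> online p lam (X lam) (pi_th lam)),
      asymp_at_1 (fun lam => fine (cost (X lam) (pi_th lam)))
        (fun lam => fine (optimal_cost (X lam) (online p lam (X lam)))) &
      asymp_at_1
        (fun lam => fine (optimal_cost (X lam) (online p lam (X lam))))
        (fun lam => log_base (1 / (1 - p)) (1 / (1 - lam)))].
Proof.
move=> pi_th; have [p0 p1] := andP hp.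
have range lam : 1 - p < lam < 1 -> [/\ 0 < lam < 1, valid_model p lam (X lam) & 1 - p < lam].
  move=> /andP[pl l1]; have l01 : 0 < lam < 1 by rewrite l1 andbT; lra.
  by split => //; exact: hX.
have feas lam : 1 - p < lam < 1 -> feasible_policy p lam (X lam) (pi_th lam).
  by move=> /range[l01 V pl]; exact: threshold_feasible.
have onl lam : 1 - p < lam < 1 -> online p lam (X lam) (pi_th lam).
  move=> hl; apply/onlineE; split; first exact: feas.
  by have [l01 V _] := range lam hl; exact: (threshold_adapted V).
split => //.
pose c lam := fine (cost (X lam) (pi_th lam)).
pose o lam := fine (optimal_cost (X lam) (online p lam (X lam))).
pose y lam := log_base (1 / (1 - p)) (1 / (1 - lam)).
have sandwich eps : 0 < eps <= 1 -> \forall lam \near 1^'-,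
    [/\ 0 < y lam, (1 - eps) * y lam <= o lam, o lam <= c lam & c lam <= (1 + eps) * y lam].
  move=> e01; have := near_one_left hp e01; apply: filterS => lam [hl M1 M2].
  have [l01 V pl] := range lam hl; have [e0 e1] := andP e01.
  have L_gt0 := threshold_level_gt0 hp l01 pl.
  have /andP[c0 cL] := threshold_cost_le (X lam) (ltW L_gt0).
  have cfin : cost (X lam) (pi_th lam) = (c lam)%:E.
    by rewrite fineK // ge0_fin_numE // (le_lt_trans cL) // ltry.
  have opt_le : (optimal_cost (X lam) (online p lam (X lam)) <= cost (X lam) (pi_th lam))%E.
    by apply: ereal_inf_lbound; exists (pi_th lam) => //; exact: onl.
  have [m m0 lower] := lower_bound_asymptotic hp hl e01 M1.
  have le_opt : (((1 - eps) * y lam)%:E <= optimal_cost (X lam) (online p lam (X lam)))%E.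
    apply: le_ereal_inf_tmp => _ [pol /onlineE[fpol apol] <-].
    apply: le_trans (online_cost_lower_bound V hp l01 pl m0 fpol apol).
    by rewrite lee_fin.
  have ofin : optimal_cost (X lam) (online p lam (X lam)) = (o lam)%:E.
    rewrite fineK //; move: opt_le le_opt; rewrite cfin.
    by case: (optimal_cost _ _).
  have M3 : 4 / eps <= y lam.
    by apply: le_trans M1; rewrite lerDl divr_ge0 // !mulr_ge0 ?exprn_ge0 ?ltW // oppr_gt0 ln_lt0 // subr_gt0 p1 gtrBl.
  split.
  - by apply: lt_le_trans M3; rewrite divr_gt0.
  - by rewrite -lee_fin -ofin.
  - by rewrite -lee_fin -ofin -cfin.
  - apply: le_trans (threshold_level_le hp hl e01 M3 M2).
    by rewrite -lee_fin -cfin.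
split => //.
- apply: asymp_at_1P => eps /andP[e0 e1].
  have e4 : 0 < eps / 4 <= 1 by apply/andP; split; lra.
  have := sandwich _ e4; apply: filterS => lam [y0 yo oc cy].
  have o0 : 0 < o lam by apply: lt_le_trans yo; rewrite mulr_gt0 //; lra.
  rewrite -/(c lam) -/(o lam) ler0_norm ?opprB; last by rewrite subr_le0 ler_pdivlMr // mul1r.
  rewrite lerBlDr ler_pdivrMr //; apply: le_trans cy _.
  apply: le_trans (_ : (eps + 1) * ((1 - eps / 4) * y lam) <= _); last by rewrite ler_pM2l //; lra.
  rewrite [leRHS]mulrA ler_pM2r //; nra.
apply: asymp_at_1P => eps e01; have := sandwich _ e01; apply: filterS => lam [y0 yo oc cy].
rewrite -/(o lam) -/(y lam) ler_norml; apply/andP; split.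
  by rewrite lerBrDr addrC lerBlDr ler_pdivrMr //; have := le_trans oc cy; lra.
by rewrite lerBlDr -lerBlDl ler_pdivlMr.
Qed.
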